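(* Let $\Theta$ be a finite simple oriented graph whose simple oriented cycles are $C_1,\ldots,C_k$ for some $k\geq 1$, and assume that $\Theta$ does not contain two different cycles connected by an oriented path (of length $\geq 0$). Then for any non-cycle vertex $x$ that is connected by an oriented path with a cycle, either all oriented paths between $x$ and the cycles are directed from $x$ into the cycles, or all of them begin at the cycles. For $j=1,\ldots,k$ let $\mathcal{A}_j$ be the set of vertices of $\Theta$ not lying on $C_j$ that are connected by an edge (in either direction) with some vertex of $C_j$. For $x\in\mathcal{A}_j$ let $k_x$ be the number of oriented paths of length $\geq 0$ in $\Theta$ that start at $x$ if all paths between $C_j$ and $x$ start at cycle vertices, and the number of oriented paths of length $\geq 0$ in $\Theta$ that end at $x$ otherwise. Then $$\operatorname{GKdim} A_{\Theta}=\sum_{j=1}^{k}\Big(\sum_{x\in\mathcal{A}_j}k_x+1\Big),$$ where the inner term $\sum_{x\in\mathcal{A}_j}k_x+1$ equals $1$ if $\mathcal{A}_j=\emptyset$. Moreover, if $\Theta$ contains no oriented cycle, then $\operatorname{GKdim}A_\Theta=0$.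
   Context: For a finite simple oriented graph $\Theta$ with vertices $x_1,\ldots,x_n$, the Hecke--Kiselman monoid $\mathrm{HK}_\Theta$ is the monoid generated by $x_1,\ldots,x_n$ subject to: $x_i^2=x_i$ for all $i$; $x_ix_j=x_jx_i$ if $x_i,x_j$ are not connected by an edge; $x_ix_jx_i=x_jx_ix_j=x_ix_j$ if there is an arrow $x_i\to x_j$. $A_\Theta$ denotes the monoid algebra $k[\mathrm{HK}_\Theta]$ over a field $k$, and $\operatorname{GKdim}$ is the Gelfand--Kirillov dimension. A path of length $0$ at a vertex $x$ counts as exactly one path starting (and ending) at $x$. Cycles are simple oriented cycles (of length $\geq 3$). *)

(* Defs.v *)
From HB Require Import structures.
From Stdlib Require Import Relations.
From mathcomp Require Import all_boot all_order all_algebra.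
From mathcomp Require Import boolp classical_sets reals ereal topology sequences exp.

Set Implicit Arguments.
Unset Strict Implicit.
Unset Printing Implicit Defensive.

Import Order.TTheory GRing.Theory Num.Theory.

Definition simple_oriented (m : nat) (arr : rel 'I_m) : Prop :=
  (forall i, ~~ arr i i) /\ (forall i j, arr i j -> ~~ arr j i).

Definition is_cycle (m : nat) (arr : rel 'I_m) (c : seq 'I_m) : bool :=
  [&& (2 < size c)%N, uniq c & cycle arr c].

Definition same_cycle (m : nat) (c1 c2 : seq 'I_m) : Prop :=
  exists r, c2 = rot r c1.

Definition on_cycle (m : nat) (arr : rel 'I_m) (x : 'I_m) : Prop :=
  exists c, is_cycle arr c /\ x \in c.

Definition cycle_enumeration (m : nat) (arr : rel 'I_m) (cs : seq (seq 'I_m))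
  : Prop :=
  [/\ forall c, c \in cs -> is_cycle arr c,
      forall c, is_cycle arr c -> exists2 c', c' \in cs & same_cycle c' c,
      uniq cs &
      forall c1 c2, c1 \in cs -> c2 \in cs -> same_cycle c1 c2 -> c1 = c2].

Definition no_linked_cycles (m : nat) (arr : rel 'I_m) : Prop :=
  forall c1 c2 x y, is_cycle arr c1 -> is_cycle arr c2 ->
    x \in c1 -> y \in c2 -> connect arr x y -> same_cycle c1 c2.

Definition attached (m : nat) (arr : rel 'I_m) (c : seq 'I_m) : {set 'I_m} :=
  [set x | (x \notin c) && has (fun y => arr x y || arr y x) c].

Definition npaths_from (m : nat) (r : rel 'I_m) (x : 'I_m) : nat :=
  \sum_(l < m) #|[set t : l.-tuple 'I_m | path r x t && uniq (x :: t)]|.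

Definition rev_rel (m : nat) (arr : rel 'I_m) : rel 'I_m := fun a b => arr b a.

Definition k_x (m : nat) (arr : rel 'I_m) (c : seq 'I_m) (x : 'I_m) : nat :=
  if has (fun y => connect arr y x) c then npaths_from arr x
  else npaths_from (rev_rel arr) x.

(* The Hecke--Kiselman monoid HK_Theta: words over the generators      *)
(* (free monoid seq 'I_m) modulo the monoid congruence generated by    *)
(* the defining relations.                                             *)

Inductive hk_rel (m : nat) (arr : rel 'I_m) : seq 'I_m -> seq 'I_m -> Prop :=
| hk_idem i : hk_rel arr [:: i; i] [:: i]
| hk_comm i j : ~~ arr i j -> ~~ arr j i -> hk_rel arr [:: i; j] [:: j; i]
| hk_arr1 i j : arr i j -> hk_rel arr [:: i; j; i] [:: i; j]
| hk_arr2 i j : arr i j -> hk_rel arr [:: j; i; j] [:: i; j].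

Definition hk_step (m : nat) (arr : rel 'I_m) (a b : seq 'I_m) : Prop :=
  exists u v l r, [/\ hk_rel arr l r, a = u ++ l ++ v & b = u ++ r ++ v].

Definition hk_eq (m : nat) (arr : rel 'I_m) : relation (seq 'I_m) :=
  clos_refl_sym_trans _ (@hk_step m arr).

(* The monoid algebra A_Theta = K[HK_Theta]: an element is a finitely  *)
(* supported K-valued function on HK_Theta, i.e. a function on words    *)
(* constant on hk_eq classes.  The basis element of the monoid element  *)
(* represented by w is the indicator of its class.                      *)

Definition hk_basis (K : fieldType) (m : nat) (arr : rel 'I_m) (w : seq 'I_m)
  : seq 'I_m -> K :=
  fun u => if `[< hk_eq arr w u >] then 1%R else 0%R.

Definition lin_indep (K : fieldType) (T : Type) (s : seq (T -> K)) : Prop :=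
  forall c : 'I_(size s) -> K,
    (forall t, (\sum_(i < size s) c i * nth (fun _ => 0) s i t)%R = 0%R) ->
    forall i, c i = 0%R.

Definition span_dim (K : fieldType) (T : Type) (s : seq (T -> K)) : nat :=
  \max_(b : (size s).-tuple bool | `[< lin_indep (mask b s) >]) size (mask b s).

(* V = span{1, x_1, ..., x_m} is the standard generating subspace of A_Theta;
   V^N is spanned by the products of N elements of {1, x_1, ..., x_m}
   (None stands for 1). *)
Definition dim_VN (K : fieldType) (m : nat) (arr : rel 'I_m) (N : nat) : nat :=
  span_dim [seq hk_basis K arr (pmap id (val t)) | t <- enum {: N.-tuple (option 'I_m)}].

Definition GKdim_HK (K : fieldType) (R : realType) (m : nat) (arr : rel 'I_m)
  : \bar R :=
  limn_esup (fun N => ((ln ((dim_VN K arr N)%:R : R) / ln (N%:R : R))%R)%:E).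

(* Main.v *)
Require Import Defs.
From HB Require Import structures.
From Stdlib Require Import Relations.
From mathcomp Require Import all_boot all_order all_algebra.
From mathcomp Require Import boolp classical_sets reals ereal topology normedtype sequences exp.
From mathcomp Require Import zify.

(** A word is reduced when any two occurrences of a letter [x] are separated by
    an in-neighbour and by an out-neighbour of [x]. Since [x u x = u x] when [u]
    has no out-neighbour of [x] and [x u x = x u] when it has no in-neighbour,
    every element of the monoid has a reduced word. Let words act on states
    attached to the vertices, the letter [x] recording at [x] the current states
    of its out-neighbours. In a reduced word every letter strictly enlarges the
    recorded history, so that the history determines the word up to commutation
    of non-adjacent letters: the elements of the monoid are the reduced words up
    to such commutations.

    In a reduced word a vertex that reaches no cycle occurs at most as often as
    there are paths starting at it, and dually. The occurrences of the vertices
    attached to a cycle [C] thus cut the letters of [C] into at most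
    [sum k_x + 1] segments, in each of which consecutive vertices of [C]
    alternate, so that it is determined by an integer and boundedly many further
    data. Conversely, writing each vertex below the cycles just before each of
    its out-neighbours (and once more at the end), and dually above them, gives a
    word in which all these bounds are attained; powers of the cycles can be
    inserted independently in all segments. *)

Set Implicit Arguments.
Unset Strict Implicit.
Unset Printing Implicit Defensive.

Import Order.TTheory GRing.Theory Num.Theory.

(* [topology] gives the name [filter] to another notion. *)
Local Notation filter := seq.filter.

(** * Separated occurrences and reduced words *)

Section Separation.
Variable T : eqType.
Implicit Types (x : T) (Y : pred T) (w : seq T) (b : bool).

(* Scans [w], checking that any two occurrences of [x] have a letter of [Y]
   between them; the flag records that an [x] has been read since the last
   letter of [Y]. *)
Fixpoint spaced x Y b w : bool :=
  if w is a :: w' then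
    if a == x then ~~ b && spaced x Y true w'
    else spaced x Y (b && ~~ Y a) w'
  else true.

(** A letter outside [P] is neither [x] nor in [Y], so scanning it leaves the flag unchanged. *)
Lemma spaced_filter x Y (P : pred T) b w :
  P x -> (forall a, Y a -> P a) ->
  spaced x Y b (filter P w) = spaced x Y b w.
Proof.
move=> Px PY; elim: w b => //= a w IHw b.
case: eqP => [->|neq_ax]; first by rewrite Px /= eqxx IHw.
case: ifP => [_|Pa] /=; first by rewrite (introF eqP neq_ax) IHw.
by rewrite IHw; case Ya: (Y a) => //=; [rewrite PY in Pa | rewrite andbT].
Qed.

Lemma spaced_sub x Y Y' b b' w :
  (forall a, a \in w -> Y a -> Y' a) -> (b' -> b) ->
  spaced x Y b w -> spaced x Y' b' w.
Proof.
elim: w b b' => //= a w IHw b b' sYY' bb'.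
have sw c : c \in w -> Y c -> Y' c by move=> cw; apply: sYY'; rewrite inE cw orbT.
case: eqP => _.
  by case/andP=> nb sw1; rewrite (contra bb' nb); apply: IHw sw1.
apply: IHw => //; case/andP=> /bb' -> /=; apply: contra.
by apply: sYY'; rewrite inE eqxx.
Qed.

(** Each gap between consecutive occurrences of [x] contains a letter of [Y]; a raised flag stands
    for one more [x] in front of [w]. *)
Lemma spaced_count x Y b w :
  spaced x Y b w -> count_mem x w + b <= (count Y w).+1.
Proof.
elim: w b => [|a w IHw] b /=; first by case: b.
case: eqP => [->|_].
  case/andP=> /negbTE -> /IHw; rewrite addn1 addn0 ltnS add1n => le.
  by rewrite ltnS (leq_trans le) // leq_addl.
move/IHw; rewrite add0n; case: (Y a); rewrite ?andbF ?andbT //= addn0 => le.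
by rewrite add1n (leq_trans (leq_add le (leq_b1 b))) // addn1.
Qed.

Lemma spaced_flagged x Y u q : spaced x Y true (u ++ x :: q) -> has Y u.
Proof.
elim: u => [|a u IHu] /=; first by rewrite eqxx.
by case: eqP => // _; case: (Y a).
Qed.

Lemma spaced_between x Y b p u q :
  spaced x Y b (p ++ x :: u ++ x :: q) -> has Y u.
Proof.
elim: p b => [|a p IHp] b /=.
  by rewrite eqxx => /andP[_]; apply: spaced_flagged.
by case: eqP => _; [case/andP=> _ /IHp | move/IHp].
Qed.

Lemma spacedPn x Y b w :
  ~~ spaced x Y b w ->
  (b /\ exists u q, w = u ++ x :: q /\ ~~ has Y u) \/
  exists p u q, w = p ++ x :: u ++ x :: q /\ ~~ has Y u.
Proof.
elim: w b => //= a w IHw b; case: eqP => [->|_].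
  rewrite negb_and negbK => /orP[bT|]; first by left; split=> //; exists [::], w.
  case/IHw=> [[_ [u [q [-> hu]]]]|[p [u [q [-> hu]]]]]; right.
    by exists [::], u, q.
  by exists (x :: p), u, q.
case/IHw=> [[/andP[-> nYa] [u [q [-> hu]]]]|[p [u [q [-> hu]]]]].
  by left; split=> //; exists (a :: u), q; rewrite /= (negbTE nYa).
by right; exists (a :: p), u, q.
Qed.

Lemma spaced_notin x Y b w : x \notin w -> spaced x Y b w.
Proof.
elim: w b => //= a w IHw b; rewrite inE negb_or eq_sym => /andP[/negbTE -> nx].
exact: IHw.
Qed.

Lemma spaced_cat_notin x Y u w :
  x \notin u -> spaced x Y false (u ++ w) = spaced x Y false w.
Proof.
elim: u => //= a u IHu; rewrite inE negb_or eq_sym => /andP[/negbTE -> nx].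
exact: IHu.
Qed.

Lemma spaced_notin_cat x Y b u w :
  x \notin w -> spaced x Y b (u ++ w) = spaced x Y b u.
Proof.
move=> nx; elim: u b => [|a u IHu] b /=; first by rewrite spaced_notin.
by rewrite !IHu.
Qed.

Lemma split_first a (w : seq T) : a \in w -> exists p q, w = p ++ a :: q /\ a \notin p.
Proof.
elim: w => //= b w IHw; rewrite inE; case: eqP => [-> _|/eqP neq /= /IHw].
  by exists [::], w.
by case=> p [q [-> nap]]; exists (b :: p), q; rewrite inE negb_or neq.
Qed.

Lemma filter_pred2_none (a b : T) (p : seq T) :
  a \notin p -> b \notin p -> filter (pred2 a b) p = [::].
Proof.
move=> ap bp; rewrite (@eq_in_filter _ _ pred0) ?filter_pred0 // => z zp /=.
by rewrite (negbTE (memPn ap z zp)) (negbTE (memPn bp z zp)).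
Qed.

Lemma filter_head_notin (P : pred T) a p q s :
  filter P (p ++ q) = a :: s -> a \notin p -> all (predC P) p.
Proof.
elim: p => //= b p IHp; rewrite inE negb_or; case: ifP => [Pb|Pb].
  by case=> ->; rewrite eqxx.
by move/IHp=> H /andP[_ /H ->].
Qed.

End Separation.

(** * Reduction and commutation in the Hecke--Kiselman monoid *)

Section HeckeKiselman.
Variables (m : nat) (arr : rel 'I_m).
Hypothesis simple : simple_oriented arr.

Local Notation "u =hk v" := (hk_eq arr u v) (at level 70).

Lemma arr_irr i : arr i i = false.
Proof. by apply/negbTE; case: simple. Qed.

Lemma arr_asym i j : arr i j -> arr j i = false.
Proof. by case: simple => _ as_ /as_/negbTE. Qed.

Definition adjacent a b := arr a b || arr b a.

Lemma adjacentC a b : adjacent a b = adjacent b a.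
Proof. by rewrite /adjacent orbC. Qed.

Lemma hk_eqC u v : u =hk v -> v =hk u.
Proof. exact: rst_sym. Qed.

Lemma hk_eq_trans v u w : u =hk v -> v =hk w -> u =hk w.
Proof. exact: rst_trans. Qed.

Lemma hk_eq_refl u : u =hk u.
Proof. exact: rst_refl. Qed.

Lemma hk_eq_cat p q u v : u =hk v -> p ++ u ++ q =hk p ++ v ++ q.
Proof.
elim=> {u v} [u v [p' [q' [l [r [lr -> ->]]]]]|u|u v _ IH|u v w _ IH1 _ IH2].
- by apply: rst_step; exists (p ++ p'), (q' ++ q), l, r; split=> //; rewrite -!catA.
- exact: rst_refl.
- exact: rst_sym.
- exact: rst_trans IH1 IH2.
Qed.

Lemma hk_eq_rel l r q : hk_rel arr l r -> l ++ q =hk r ++ q.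
Proof. by move=> lr; apply: rst_step; exists [::], q, l, r. Qed.

Lemma hk_eq_cons a u v : u =hk v -> a :: u =hk a :: v.
Proof. by move/(hk_eq_cat [:: a] [::]); rewrite !cats0. Qed.

Lemma hk_swap a b q : ~~ adjacent a b -> [:: a, b & q] =hk [:: b, a & q].
Proof.
rewrite negb_or => /andP[nab nba].
exact: (hk_eq_rel q (hk_comm nab nba)).
Qed.

Lemma hk_move a p q :
  (forall b, b \in p -> ~~ adjacent a b) -> p ++ a :: q =hk a :: p ++ q.
Proof.
elim: p => [_|b p IHp nadj] /=; first exact: hk_eq_refl.
apply: (@hk_eq_trans (b :: a :: p ++ q)).
  by apply: hk_eq_cons; apply: IHp => c cp; apply: nadj; rewrite inE cp orbT.
by apply: hk_swap; rewrite adjacentC; apply: nadj; rewrite inE eqxx.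
Qed.

Lemma hk_dup z x q : ~~ arr x z -> [:: x, z, x & q] =hk [:: z, x & q].
Proof.
move=> nxz; case zx: (arr z x); first exact: (hk_eq_rel q (hk_arr2 zx)).
apply: (@hk_eq_trans [:: z, x, x & q]).
  by apply: hk_swap; rewrite /adjacent (negbTE nxz) zx.
by apply: hk_eq_cons; exact: (hk_eq_rel q (hk_idem arr x)).
Qed.

Lemma hk_dup' z x q : ~~ arr z x -> [:: x, z, x & q] =hk [:: x, z & q].
Proof.
move=> nzx; case xz: (arr x z); first exact: (hk_eq_rel q (hk_arr1 xz)).
apply: (@hk_eq_trans [:: x, x, z & q]).
  by apply: hk_eq_cons; apply: hk_swap; rewrite /adjacent (negbTE nzx) xz.
exact: (hk_eq_rel (z :: q) (hk_idem arr x)).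
Qed.

(** By induction on [u]: the hypothesis, read backwards, creates an [x] behind the first letter [z];
    then [xzx = zx] removes the front [x], and the hypothesis removes the new one. *)
Lemma hk_absorb_left x u q : ~~ has (arr x) u -> x :: u ++ x :: q =hk u ++ x :: q.
Proof.
elim: u => [_|z u IHu] /=; first exact: (hk_eq_rel q (hk_idem arr x)).
rewrite negb_or => /andP[nxz /IHu eq_u].
apply: (@hk_eq_trans [:: x, z, x & u ++ x :: q]).
  by apply: hk_eq_cons; apply: hk_eq_cons; apply: hk_eqC.
by apply: (hk_eq_trans (hk_dup _ nxz)); apply: hk_eq_cons.
Qed.

Lemma hk_absorb_right x u q :
  ~~ has (rev_rel arr x) u -> x :: u ++ x :: q =hk x :: u ++ q.
Proof.
elim: u => [_|z u IHu] /=; first exact: (hk_eq_rel q (hk_idem arr x)).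
rewrite negb_or => /andP[nzx /IHu eq_u].
(* Dually, [xz = xzx] creates the [x] that absorbs the last one and is then removed again. *)
apply: (@hk_eq_trans [:: x, z, x & u ++ x :: q]).
  by apply: hk_eqC; apply: hk_dup'.
apply: (@hk_eq_trans [:: x, z, x & u ++ q]); last exact: hk_dup'.
by apply: hk_eq_cons; apply: hk_eq_cons.
Qed.

Definition reduced w :=
  [forall x, spaced x (arr x) false w && spaced x (rev_rel arr x) false w].

Lemma reducedP w :
  reflect (forall x, spaced x (arr x) false w /\
                     spaced x (rev_rel arr x) false w) (reduced w).
Proof.
apply: (iffP forallP) => H x; first by apply/andP.
by case: (H x) => -> ->.
Qed.

(** Every violation allows one letter to be deleted. The length bound makes reduced representatives
    available inside [V^N]. *)
Lemma exists_reduced w :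
  exists w', [/\ w =hk w', size w' <= size w & reduced w'].
Proof.
have [n] := ubnP (size w); elim: n w => // n IHn w ltwn.
case: (boolP (reduced w)) => [rw|].
  by exists w; split=> //; apply: hk_eq_refl.
case/forallPn=> x; rewrite negb_and => H.
have [w1 [eq_w1 lt_w1]] : exists w1, w =hk w1 /\ size w1 < size w.
  case/orP: H => /spacedPn [[]//|[p [u [q [-> hu]]]]].
    exists (p ++ u ++ x :: q); split.
      by have := hk_eq_cat p [::] (hk_absorb_left q hu); rewrite !cats0.
    by rewrite !size_cat /= !size_cat /= ltn_add2l.
  exists (p ++ x :: u ++ q); split.
    by have := hk_eq_cat p [::] (hk_absorb_right q hu); rewrite !cats0.
  by rewrite !size_cat /= !size_cat /= ltn_add2l !ltnS ltn_add2l.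
have [|w' [eq_w' le_w' rw']] := IHn w1; first exact: leq_trans lt_w1 _.
exists w'; split=> //; first exact: hk_eq_trans eq_w1 eq_w'.
exact: leq_trans le_w' (ltnW lt_w1).
Qed.

(** The projection criterion for equality of traces, that is, of words up to commutation of
    non-adjacent letters. The pairs with [a = b] record the multiplicities. *)
Definition same_projections u v :=
  forall a b, (a == b) || adjacent a b ->
  filter (pred2 a b) u = filter (pred2 a b) v.

(** The first letter [a] of [u] can be moved to the front of [v]: a neighbour of [a] standing before
    the first [a] of [v] would give a projection with a different first letter. *)
Lemma same_projections_hk u v : same_projections u v -> u =hk v.
Proof.
elim: u v => [|a u IHu] v prj.
  case: v prj => [|b v] prj; first exact: hk_eq_refl.
  by have := prj b b; rewrite !eqxx /= eqxx => /(_ isT).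
have av : a \in v.
  have := prj a a; rewrite eqxx => /(_ isT) /= /esym eqf.
  have : a \in filter (pred2 a a) v by rewrite eqf eqxx inE eqxx.
  by rewrite mem_filter => /andP[].
have [p [q [def_v nap]]] := split_first av; rewrite {v av}def_v in prj *.
have nadj b : b \in p -> ~~ adjacent a b.
  move=> bp; apply/negP => ab; have := prj a b; rewrite ab orbT => /(_ isT) eqf.
  rewrite /= eqxx in eqf; have /allP/(_ b bp) := filter_head_notin (esym eqf) nap.
  by rewrite /= eqxx orbT.
apply: hk_eq_trans (hk_eqC (hk_move q nadj)); apply: hk_eq_cons.
apply: IHu => b c bc; have := prj b c bc; rewrite !filter_cat /=.
case: ifP => // abc; suff -> : filter (pred2 b c) p = [::] by case.
apply: filter_pred2_none; apply/negP => inp.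
  have := nadj b inp; rewrite /=; case/orP: abc => /eqP ab.
    by case/negP: nap; rewrite ab.
  case/orP: bc => [/eqP eqbc|]; last by rewrite adjacentC -ab => ->.
  by case/negP: nap; rewrite ab -eqbc.
have := nadj c inp; rewrite /=; case/orP: abc => /eqP ab.
  case/orP: bc => [/eqP eqbc|]; last by rewrite -ab => ->.
  by case/negP: nap; rewrite ab eqbc.
by case/negP: nap; rewrite ab.
Qed.

End HeckeKiselman.

(** * Histories *)

(** A [Read] node stores what a letter saw when it last acted; [Unread] marks a letter that has not
    acted. *)
Inductive history (T : Type) : Type :=
| Unread
| Read of (T -> history T).
Arguments Unread {T}.

Fixpoint hsize (T : finType) (h : history T) : nat :=
  if h is Read f then (\sum_(i : T) hsize (f i)).+1 else 0.

Section Histories.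
Variables (m : nat) (arr : rel 'I_m).
Hypothesis simple : simple_oriented arr.

Local Notation "u =hk v" := (hk_eq arr u v) (at level 70).
Local Notation adjacent := (adjacent arr).
Local Notation reduced := (reduced arr).

(* Words act from right to left on the states of the vertices, the letter [t]
   recording at [t] the current states of the out-neighbours of [t]; this
   action is compatible with the defining relations. *)
Fixpoint state (w : seq 'I_m) : 'I_m -> history 'I_m :=
  if w is t :: w' then
    fun j => if j == t then Read (fun i => if arr t i then state w' i else Unread)
             else state w' j
  else fun=> Unread.

Definition past t w := fun i : 'I_m => if arr t i then state w i else Unread.

Lemma state_cons t w j :
  state (t :: w) j = if j == t then Read (past t w) else state w j.
Proof. by []. Qed.

Lemma state_cat_eq u v w : state v = state w -> state (u ++ v) = state (u ++ w).
Proof. by move=> eq_vw; elim: u => //= t u ->. Qed.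

Lemma hk_state u v : u =hk v -> state u = state v.
Proof.
elim=> {u v} [u v [p [q [l [r [lr -> ->]]]]]|u|u v _ ->|u v w _ -> _ ->] //.
apply: state_cat_eq; case: lr => {l r} [i|i j nij nji|i j ij|i j ij];
  apply/funext => k; rewrite /= -/(state q).
- case: eqP => // _; congr Read; apply: funext => l; case: ifP => // il.
  by case: eqP => // li; rewrite li arr_irr in il.
- have [->//|nij'] := eqVneq i j.
  have [->|nki] := eqVneq k i; [rewrite (negbTE nij') ?eqxx | case: eqP => // _];
    congr Read; apply: funext => l; case: ifP => // il;
    case: eqP => // eql; rewrite -eql.
  + by rewrite -eql il in nij.
  + by rewrite -eql il in nji.
(* The second action of [i] overwrites the first, and [j], acting in between, does not read [i]. *)
- have noi l : arr j l -> (l == i) = false.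
    by apply: contraTF => /eqP ->; rewrite (arr_asym simple ij).
  have noj l : arr j l -> (l == j) = false.
    by apply: contraTF => /eqP ->; rewrite arr_irr.
  case: (k =P i) => _.
    congr Read; apply: funext => l; case: ifP => // il.
    case: eqP => [_|_]; last by case: eqP => // li; rewrite li arr_irr in il.
    by congr Read; apply: funext => h; case: ifP => // /noi ->.
  case: eqP => // _; congr Read; apply: funext => h; case: ifP => // jh.
  by rewrite noi.
(* The second action of [j] repeats the first, since nothing that [j] reads has changed in
   between. *)
- case: (k =P j) => [->|_]; case: eqP => // [ji|_].
    by rewrite ji arr_irr in ij.
  congr Read; apply: funext => l; case: ifP => // jl.
  case: eqP => [li|_]; first by rewrite li (arr_asym simple ij) in jl.
  by case: eqP => // lj; rewrite lj arr_irr in jl.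
Qed.

Lemma state_notin j u w : j \notin u -> state (u ++ w) j = state w j.
Proof.
elim: u => // t u IHu; rewrite inE negb_or => /andP[/negbTE jt /IHu].
by rewrite cat_cons state_cons jt.
Qed.

Lemma state_first j u w : j \notin u -> state (u ++ j :: w) j = Read (past j w).
Proof. by move=> /state_notin ->; rewrite state_cons eqxx. Qed.

Lemma state_notin_nil j w : j \notin w -> state w j = Unread.
Proof. by move=> nj; rewrite -[w]cats0 state_notin. Qed.

Lemma state_Read j w f : state w j = Read f -> j \in w.
Proof. by move=> eqf; apply/negPn/negP => /state_notin_nil; rewrite eqf. Qed.

Lemma reduced_suffix u w : reduced (u ++ w) -> reduced w.
Proof.
elim: u => // a u IHu /reducedP rw; apply: IHu; apply/reducedP => x.
have sep (Y : pred 'I_m) (w' : seq 'I_m) :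
    spaced x Y false (a :: w') -> spaced x Y false w'.
  rewrite /=; case: eqP => // _; exact: spaced_sub.
by case: (rw x) => /sep ? /sep.
Qed.

Let wt w j := hsize (state w j).

(** What a new front letter [t] records is compared with what the nearest [t] to its right recorded:
    an out-neighbour of [t] lies between them, so its state has grown strictly by induction, while
    no other state has shrunk. *)
Lemma hsize_growth u w : reduced (u ++ w) ->
  (forall j, wt w j <= wt (u ++ w) j) /\ (forall j, j \in u -> wt w j < wt (u ++ w) j).
Proof.
have [n] := ubnP (size (u ++ w)); elim: n u w => // n IHn [|t u] w //.
rewrite cat_cons ltnS => lt_n red; have red' : reduced (u ++ w).
  by apply: (@reduced_suffix [:: t]).
have [mono strict] := IHn u w lt_n red'.
suff key : wt (u ++ w) t < wt (t :: u ++ w) t.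
  have le j : wt (u ++ w) j <= wt (t :: u ++ w) j.
    by have [->|/negbTE jt] := eqVneq j t; [apply: ltnW | rewrite /wt state_cons jt].
  split=> j; first exact: leq_trans (mono j) (le j).
  rewrite inE => /orP[/eqP ->|/strict lt_j]; last exact: leq_trans lt_j (le j).
  exact: leq_ltn_trans (mono t) key.
rewrite {2}/wt state_cons eqxx.
have [tin|tnin] := boolP (t \in u ++ w); last by rewrite /wt state_notin_nil.
have [p [q [def_w ntp]]] := split_first tin; rewrite def_w in lt_n red red' *.
rewrite /wt state_first //= ltnS.
have growth p' q' : p ++ t :: q = p' ++ q' ->
    forall j, wt q' j <= wt (p ++ t :: q) j.
  by move=> eqpq; have := IHn p' q'; rewrite -eqpq => /(_ lt_n red') [].
have grow_q := growth (rcons p t) q; rewrite cat_rcons in grow_q.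
have [sep_t _] := reducedP _ _ red t.
have /hasP[y yp ty] := @spaced_between _ t (arr t) false [::] p q sep_t.
rewrite (bigD1 y) //= [X in _ < X](bigD1 y) //= /past ty -addSn leq_add //.
  have [p1 [p2 [def_p nyp]]] := split_first yp.
  have := IHn [:: y] (p2 ++ t :: q); rewrite /= => -[].
  - by move: lt_n; rewrite def_p !size_cat /= !size_cat /=; lia.
  - by apply: (@reduced_suffix p1); rewrite def_p -catA in red'.
  move=> _ /(_ y); rewrite inE eqxx => /(_ isT) lty.
  apply: (@leq_trans (wt (y :: p2 ++ t :: q) y)).
    apply: leq_ltn_trans lty.
    have := IHn (rcons p2 t) q; rewrite cat_rcons => -[].
    - by move: lt_n; rewrite def_p !size_cat /= !size_cat /=; lia.
    - apply: (@reduced_suffix (rcons p1 y)).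
      by rewrite def_p -catA /= -cat_rcons in red'.
    by move=> /(_ y).
  by have := growth p1 (y :: p2 ++ t :: q); rewrite def_p -catA; apply.
by apply: leq_sum => i _; case: ifP => // _; apply: grow_q.
Qed.

(** Separation for [x] depends only on [x] and its neighbours. If [t] is [x], none of these occurs
    in [q]; if [t] is a neighbour of [x], then [x] does not occur in [q]; otherwise [t] is not seen
    at all. *)
Lemma reduced_remove q t p :
  t \notin q -> (forall y, y \in q -> ~~ adjacent t y) ->
  reduced (q ++ t :: p) -> reduced (t :: q ++ p).
Proof.
move=> tq nadj /reducedP red; apply/reducedP => x.
have key (Y : pred 'I_m) : (forall y, Y y -> adjacent x y) ->
    spaced x Y false (q ++ t :: p) -> spaced x Y false (t :: q ++ p).
  move=> Yadj; pose P := [pred z | (z == x) || Y z].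
  have Px : P x by rewrite /= eqxx.
  have PY a : Y a -> P a by move=> /= ->; rewrite orbT.
  rewrite -(spaced_filter false (q ++ t :: p) Px PY).
  rewrite -(spaced_filter false (t :: q ++ p) Px PY) /=.
  rewrite filter_cat /= filter_cat.
  have [xt|nxt] := eqVneq x t; last first.
    case: (boolP (Y t)) => Yt; last by [].
    have nxq : x \notin q.
      by apply/negP => /nadj; rewrite adjacentC => /negP; apply; apply: Yadj.
    rewrite orbT spaced_cat_notin ?mem_filter ?(negbTE nxq) ?andbF //.
    rewrite /= eq_sym (negbTE nxt) spaced_cat_notin //.
    by rewrite mem_filter (negbTE nxq) andbF.
  rewrite [filter P q](_ : _ = [::]) //.
  apply/eqP; rewrite -size_eq0 size_filter -leqn0 leqNgt -has_count.
  apply/hasPn => y yq; rewrite /= negb_or.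
  have [eqyx|_] := eqVneq y x.
    by move: tq; rewrite -xt -eqyx yq.
  by apply: contra (nadj y yq) => /Yadj; rewrite xt.
case: (red x) => sep1 sep2; split; apply: key => // y.
  by rewrite /adjacent => ->.
by rewrite /adjacent /rev_rel => ->; rewrite orbT.
Qed.

(** The front [t] hides its previous state, but an in-neighbour [z] between it and the next [t] of
    [w] still remembers that state. Equality of the states at [z] shows that [v] passed through the
    same state of [t]; a further [t] in [v] would have enlarged it, against the inequality. *)
Lemma state_uncons_le t w v :
  reduced (t :: w) -> reduced (t :: v) -> state (t :: w) = state (t :: v) ->
  wt v t <= wt w t -> state w t = state v t.
Proof.
move=> redw redv eqs le.
have eq_wt j : wt (t :: w) j = wt (t :: v) j by rewrite /wt eqs.
have [tw|ntw] := boolP (t \in w); last first.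
  move: le; rewrite /wt (state_notin_nil ntw) /=.
  by case: (state v t).
have [u [w2 [def_w ntu]]] := split_first tw; rewrite def_w in redw eqs le *.
have [_ sep] := reducedP _ _ redw t.
have /hasP[z zu zt] := @spaced_between _ t _ false [::] u w2 sep.
have nzt : (z == t) = false.
  by apply: contraTF zt => /eqP ->; rewrite /rev_rel arr_irr.
rewrite /rev_rel in zt; have [u1 [u2 [def_u nzu]]] := split_first zu.
have ntu2 : t \notin u2 by move: ntu; rewrite def_u mem_cat inE !negb_or => /and3P[].
have eqz := congr1 (fun s => s z) eqs; rewrite !state_cons nzt in eqz.
rewrite {1}def_u -catA cat_cons (state_first _ nzu) in eqz.
have [r1 [r2 [def_v nzr]]] := split_first (state_Read (esym eqz)).
rewrite def_v (state_first _ nzr) in eqz.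
case: eqz => /(congr1 (fun f => f t)).
rewrite /past zt (state_notin _ ntu2) => eqt.
rewrite (state_notin _ ntu) eqt def_v.
have [tr|ntr] := boolP (t \in r1); last first.
  by rewrite state_notin // state_cons eq_sym nzt.
have redv' : reduced (rcons r1 z ++ r2).
  by rewrite cat_rcons -def_v; apply: (@reduced_suffix [:: t]).
have [_ /(_ t)] := hsize_growth redv'.
rewrite mem_rcons inE tr orbT => /(_ isT); rewrite cat_rcons -def_v => lt.
by move: le; rewrite leqNgt {1}/wt (state_notin _ ntu) eqt lt.
Qed.

Lemma state_uncons t w v :
  reduced (t :: w) -> reduced (t :: v) -> state (t :: w) = state (t :: v) ->
  state w = state v.
Proof.
move=> redw redv eqs; apply: funext => j; have [->|njt] := eqVneq j t; last first.
  by have := congr1 (fun s => s j) eqs; rewrite !state_cons (negbTE njt).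
case: (leqP (wt v t) (wt w t)) => [le|/ltnW le]; first exact: state_uncons_le.
by apply: esym; apply: state_uncons_le.
Qed.

(** In [v], only letters not adjacent to [t] precede the first [t]. An out-neighbour there would
    have grown since [t] read it, while in [t :: w] it has not. An in-neighbour there would remember
    the final state of [t], which [t :: w] reaches only with its very last action. So [t] can be
    moved to the front and stripped off. *)
Lemma state_same_projections u v :
  reduced u -> reduced v -> state u = state v -> same_projections arr u v.
Proof.
elim: u v => [|t w IHw] v redw redv eqs.
  case: v redv eqs => // t v _ /(congr1 (fun s => s t)).
  by rewrite state_cons eqxx.
have eqt := congr1 (fun s => s t) eqs; rewrite state_cons eqxx in eqt.
have [q [p [def_v ntq]]] := split_first (state_Read (esym eqt)).
rewrite {v}def_v in redv eqs eqt *.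
rewrite (state_first _ ntq) in eqt; case: eqt => eqt.
have grow_p j : j \in q -> wt p j < wt (q ++ t :: p) j.
  move=> jq; have := @hsize_growth (rcons q t) p; rewrite cat_rcons => -[] // _.
  by apply; rewrite mem_rcons inE jq orbT.
have nadj y : y \in q -> ~~ adjacent t y.
  move=> yq; have nyt : (y == t) = false by apply/negbTE/(memPn ntq).
  have eqy := congr1 (fun s => s y) eqs; rewrite state_cons nyt in eqy.
  apply/negP => /orP[ty|yt].
    have := congr1 (fun f => f y) eqt; rewrite /past ty eqy => eqyp.
    by have := grow_p y yq; rewrite /wt eqyp ltnn.
  have [q1 [q2 [def_q nyq]]] := split_first yq.
  have ntq2 : t \notin q2 by move: ntq; rewrite def_q mem_cat inE !negb_or => /and3P[].
  rewrite def_q -catA cat_cons (state_first _ nyq) in eqy.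
  have [r1 [r2 [def_w nyr]]] := split_first (state_Read eqy).
  rewrite def_w (state_first _ nyr) in eqy.
  case: eqy => /(congr1 (fun f => f t)); rewrite /past yt.
  rewrite (state_first _ ntq2) -eqt => eqr.
  have := @hsize_growth [:: t & rcons r1 y] r2.
  rewrite cat_cons cat_rcons -def_w => -[] // _ /(_ t).
  by rewrite inE eqxx => /(_ isT); rewrite /wt eqr state_cons eqxx ltnn.
have redv' := reduced_remove ntq nadj redv.
have eq_move := hk_state (hk_move p nadj).
have prj : same_projections arr w (q ++ p).
  apply: IHw.
  - exact: (@reduced_suffix [:: t]).
  - exact: (@reduced_suffix [:: t]).
  - by apply: (@state_uncons t) => //; rewrite eqs eq_move.
move=> b c bc; have := prj b c bc; rewrite !filter_cat /= => ->.
case: ifP => // tbc; suff -> : filter (pred2 b c) q = [::] by [].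
suff [bq cq] : b \notin q /\ c \notin q by exact: filter_pred2_none.
case/orP: bc => [/eqP eqbc|bc].
  by move: tbc; rewrite eqbc /= orbb => /eqP <-.
by case/orP: tbc => /eqP tb; split; rewrite -?tb // ; apply/negP => /nadj;
  rewrite tb ?bc // adjacentC bc.
Qed.

Theorem hk_eq_reduced u v :
  reduced u -> reduced v -> u =hk v -> same_projections arr u v.
Proof. by move=> redu redv /hk_state; apply: state_same_projections. Qed.

End Histories.

(** * Dimension and growth *)

Section Dimension.
Variables (K : fieldType) (m : nat) (arr : rel 'I_m).

Local Notation "u =hk v" := (hk_eq arr u v) (at level 70).
Local Notation basis := (hk_basis K arr).

Lemma hk_basis_eq u v : u =hk v -> basis u = basis v.
Proof.
move=> uv; apply/funext => w; rewrite /hk_basis.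
suff -> : `[< u =hk w >] = `[< v =hk w >] by [].
apply: asbool_equiv_eq; split=> H; first exact: hk_eq_trans (hk_eqC uv) H.
exact: hk_eq_trans uv H.
Qed.

Lemma lin_indep_nth_inj (T : Type) (s : seq (T -> K)) (i j : 'I_(size s)) :
  lin_indep s -> nth (fun=> 0%R) s i = nth (fun=> 0%R) s j -> i = j.
Proof.
move=> indep eqs; apply: contrapT => /eqP neq.
pose c (k : 'I_(size s)) : K := ((k == i)%:R - (k == j)%:R)%R.
have /(_ i) : forall k, c k = 0%R.
  apply: indep => t; rewrite (bigD1 i) //= (bigD1 j) /=; last by rewrite eq_sym.
  rewrite big1 => [|k /andP[/negbTE ki /negbTE kj]]; last first.
    by rewrite /c ki kj subrr mul0r.
  by rewrite /c !eqxx (negbTE neq) eq_sym (negbTE neq) eqs subr0 sub0r mul1r mulN1r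
             addr0 subrr.
by rewrite /c eqxx (negbTE neq) subr0 => /eqP; rewrite oner_eq0.
Qed.

(** Independent basis vectors are distinct, so their words lie in distinct classes and [f] takes
    distinct values on them. *)
Lemma dim_VN_le (X : finType) (f : seq 'I_m -> X) N :
  (forall u v, size u <= N -> size v <= N -> f u = f v -> u =hk v) ->
  dim_VN K arr N <= #|X|.
Proof.
move=> f_inj; apply/bigmax_leqP => b /asboolP.
set s := mask b _ => indep.
have rep (i : 'I_(size s)) : exists w, size w <= N /\ nth (fun=> 0%R) s i = basis w.
  have : exists2 t, t \in enum {: N.-tuple (option 'I_m)} &
      nth (fun=> 0%R) s i = basis (pmap id (val t)).
    rewrite /s; move: i; rewrite /s; move: (b : seq bool).
    elim: (enum _) => [|t e IHe] [|[] b'] /=; try by case.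
      case=> -[|i] lti /=; first by exists t; rewrite ?inE ?eqxx.
      have [t' te ->] := IHe b' (Ordinal (lti : i < _)).
      by exists t'; rewrite ?inE ?te ?orbT.
    by move=> i; have [t' te ->] := IHe b' i; exists t'; rewrite ?inE ?te ?orbT.
  case=> t _ ->; exists (pmap id (val t)); split=> //.
  by rewrite size_pmap (leq_trans (count_size _ _)) // size_tuple.
pose w i := sval (cid (rep i)).
have [wsize wE] : (forall i, size (w i) <= N) /\
    (forall i : 'I_(size s), nth (fun=> 0%R) s i = basis (w i)).
  by split=> i; rewrite /w; case: cid => ? [].
rewrite -[size s]card_ord; apply: (@leq_card _ _ (f \o w)) => i j /= fij.
apply: (lin_indep_nth_inj indep); rewrite !wE; apply: hk_basis_eq.
exact: f_inj.
Qed.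

(** Indicators of distinct classes are independent: evaluating a relation at [g e] isolates one
    coefficient. Words are padded with [None] to length [N], and the mask selects exactly these
    tuples. *)
Lemma dim_VN_ge (E : finType) (g : E -> seq 'I_m) N :
  (forall e, size (g e) <= N) ->
  (forall e e', g e =hk g e' -> e = e') ->
  #|E| <= dim_VN K arr N.
Proof.
move=> sz g_inj.
pose pad e := [seq Some x | x <- g e] ++ nseq (N - size (g e)) None.
have size_pad e : size (pad e) == N.
  by rewrite size_cat size_map size_nseq subnKC.
pose tup e : N.-tuple (option 'I_m) := Tuple (size_pad e).
have tupE e : pmap id (val (tup e)) = g e.
  rewrite /= /pad pmap_cat map_pK // (_ : pmap _ _ = [::]) ?cats0 //.
  by elim: (N - _).
have tup_inj : injective tup.
  by move=> e e' eqt; apply: g_inj; rewrite -!tupE eqt; apply: hk_eq_refl.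
pose T := {: N.-tuple (option 'I_m)}.
pose F (t : N.-tuple (option 'I_m)) := basis (pmap id (val t)).
pose P (t : N.-tuple (option 'I_m)) := t \in codom tup.
set s := map F (enum T).
have size_b : size (map P (enum T)) == size s by rewrite !size_map.
have maskE : mask (map P (enum T)) s = map F (filter P (enum T)).
  by rewrite /s -map_mask filter_mask.
have size_mask : size (filter P (enum T)) = #|E|.
  rewrite -(card_codom tup_inj) cardE; apply: perm_size; apply: uniq_perm.
  - by rewrite filter_uniq ?enum_uniq.
  - exact: enum_uniq.
  by move=> t; rewrite mem_filter !mem_enum andbT.
rewrite /dim_VN /span_dim -/s.
have -> : #|E| = size (mask (Tuple size_b) s) by rewrite maskE size_map.
apply: (leq_bigmax_cond (Tuple size_b)); apply/asboolP; rewrite /= maskE.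
rewrite /lin_indep => c c0 i.
have lti : i < size (filter P (enum T)) by rewrite -(size_map F) ltn_ord.
pose t0 : N.-tuple (option 'I_m) := [tuple None | _ < N].
pose tn (k : nat) := nth t0 (filter P (enum T)) k.
have /codomP[e def_e] : tn i \in codom tup.
  by have := mem_nth t0 lti; rewrite mem_filter => /andP[].
have := c0 (g e); rewrite (bigD1 i) //= big1 ?addr0 => [|j nij].
  rewrite (nth_map t0) // -/(tn i) def_e /F tupE /hk_basis asboolT ?mulr1 //.
  exact: hk_eq_refl.
have ltj : j < size (filter P (enum T)) by rewrite -(size_map F) ltn_ord.
have /codomP[e' def_e'] : tn j \in codom tup.
  by have := mem_nth t0 ltj; rewrite mem_filter => /andP[].
rewrite (nth_map t0) // -/(tn j) def_e' /F tupE /hk_basis asboolF ?mulr0 //.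
move/g_inj => eqe; case/eqP: nij; apply: val_inj => /=.
apply/eqP; rewrite -(nth_uniq t0 ltj lti); last exact: filter_uniq (enum_uniq _).
by rewrite -/(tn i) -/(tn j) def_e def_e' eqe.
Qed.

End Dimension.

(** * Growth exponents as limits of logarithmic quotients *)

Section Growth.
Import numFieldNormedType.Exports.
Local Open Scope classical_set_scope.
Local Open Scope ring_scope.
Variable R : realType.

Lemma ln_nat_cvg_pinfty : ln (N%:R : R) @[N --> \oo] --> +oo.
Proof.
apply/cvgryPge => A.
have [k _ kA] : exists2 k : nat, True & expR A <= k%:R.
  exists (Num.bound (expR A)) => //.
  by rewrite ltW // archi_boundP // expR_ge0.
exists k => // N /= kN.
have AN : expR A <= N%:R by rewrite (le_trans kA) // ler_nat.
by rewrite -(expRK A) ler_ln ?posrE ?expR_gt0 // (lt_le_trans (expR_gt0 A)).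
Qed.

Lemma cvg_affine_over_ln (a d : R) : (a + d * ln N%:R) / ln N%:R @[N --> \oo] --> d.
Proof.
have inv0 : (ln (N%:R : R))^-1 @[N --> \oo] --> (0 : R).
  apply/gtr0_cvgV0; last exact: ln_nat_cvg_pinfty.
  by exists 2%N => // N /= N2; rewrite ln_gt0 // ltr1n.
have : a * (ln (N%:R : R))^-1 + d @[N --> \oo] --> a * 0 + d.
  by apply: cvgD; [apply: cvgMr | apply: cvg_cst].
rewrite mulr0 add0r; apply: cvg_trans; apply: near_eq_cvg.
exists 2%N => // N /= N2; rewrite mulrDl mulfK //.
by rewrite gt_eqF // ln_gt0 // ltr1n.
Qed.

(** After division by [ln N] both bounds tend to [d]; the sequence is squeezed, and its upper limit
    is its limit. *)
Lemma limn_esup_growth (dim : nat -> nat) (C k d : nat) :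
  (0 < k)%N ->
  (forall N, (dim N <= C * N.+1 ^ d)%N) ->
  (forall n N, (0 < n)%N -> (n * k <= N)%N -> (n ^ d <= dim N)%N) ->
  limn_esup (fun N => (ln ((dim N)%:R : R) / ln (N%:R : R))%:E) = (d%:R : R)%:E.
Proof.
move=> k0 upper lower.
(* [lo] comes from [N %/ k >= N / (2 * k)] and [hi] from [N.+1 <= 2 * N]. *)
pose lo N : R := (- (d%:R * ln (2 * k)%:R) + d%:R * ln N%:R) / ln N%:R.
pose hi N : R := (ln (C * 2 ^ d)%:R + d%:R * ln N%:R) / ln N%:R.
(* The lower bound for [n = 1] makes [dim k] positive, which rules out [C = 0]. *)
have C0 : (0 < C)%N.
  by have := leq_trans (lower 1%N k isT (eq_leq (mul1n k))) (upper k); rewrite exp1n; case: (posnP C) => // ->; rewrite mul0n.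
have cvg_u : ln ((dim N)%:R : R) / ln (N%:R : R) @[N --> \oo] --> (d%:R : R).
  apply: (@squeeze_cvgr _ _ _ _ lo hi); [|exact: cvg_affine_over_ln..].
  exists (k + 2)%N => // N /= leN.
  have N2 : (2 <= N)%N by lia.
  have N0 : (0 : R) < N%:R by rewrite ltr0n; lia.
  have lnN : 0 < ln (N%:R : R) by rewrite ln_gt0 // ltr1n.
  have q0 : (0 < N %/ k)%N by rewrite divn_gt0 //; lia.
  have dlow := lower _ N q0 (leq_trunc_div N k).
  have dim0 : (0 < dim N)%N by apply: leq_trans dlow; rewrite expn_gt0 q0.
  rewrite /lo /hi !ler_pM2r ?invr_gt0 //; apply/andP; split.
    have le2 : N%:R / (2 * k)%:R <= (N %/ k)%:R :> R.
      rewrite ler_pdivrMr ?ltr0n; last by lia.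
      rewrite -natrM ler_nat.
      have := ltn_ceil N k0; move: (N %/ k)%N q0 => q q0; nia.
    rewrite addrC -mulrBr -ln_div ?posrE ?ltr0n //; [|lia..].
    apply: (@le_trans _ _ (d%:R * ln (N %/ k)%:R)).
      rewrite ler_wpM2l ?ler0n // ler_ln // posrE ?ltr0n //.
      by rewrite divr_gt0 ?ltr0n //; lia.
    rewrite mulr_natl -lnXn ?ltr0n // -natrX ler_ln ?posrE ?ltr0n ?ler_nat //.
    by rewrite expn_gt0 q0.
  have CN0 : (0 < C * 2 ^ d)%N by rewrite muln_gt0 C0 expn_gt0.
  have Nd0 : (0 < N ^ d)%N by rewrite expn_gt0; lia.
  rewrite mulr_natl -lnXn // -natrX -lnM ?posrE ?ltr0n // -natrM.
  rewrite ler_ln ?posrE ?ltr0n ?ler_nat //; last by rewrite muln_gt0 CN0.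
  apply: leq_trans (upper N) _; rewrite -mulnA leq_mul2l -expnMn; apply/orP; right.
  by case: (d) => // d'; rewrite leq_exp2r //; lia.
have cvg_E : (ln ((dim N)%:R : R) / ln (N%:R : R))%:E @[N --> \oo] --> (d%:R : R)%:E.
  by apply: cvg_EFin cvg_u; apply: nearW.
rewrite is_cvg_limn_esupE; first exact/cvg_lim.
by apply/cvg_ex; exists (d%:R : R)%:E.
Qed.

End Growth.

(** * Paths and occurrences *)

Section PathCounting.
Variables (m : nat) (r : rel 'I_m).

(** Walks from such an [x] never repeat a vertex, so [npaths_from] counts all of them and satisfies
    a recursion. *)
Definition acyclic_from x := forall y z, connect r x y -> r y z -> ~~ connect r z y.

Lemma acyclic_from_connect x y : acyclic_from x -> connect r x y -> acyclic_from y.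
Proof. by move=> ax xy z t yz; apply: ax; apply: connect_trans xy yz. Qed.

Lemma acyclic_from_step x y : acyclic_from x -> r x y -> acyclic_from y.
Proof. by move=> ax xy; apply: acyclic_from_connect ax (connect1 xy). Qed.

Lemma acyclic_from_uniq x t : acyclic_from x -> path r x t -> uniq (x :: t).
Proof.
elim: t x => // z t IHt x ax /= /andP[xz pt].
have /= -> := IHt z (acyclic_from_step ax xz) pt; rewrite andbT.
apply/negP => xin; have := ax x z (connect0 r x) xz.
by rewrite (path_connect pt).
Qed.

Let npaths_len l x := #|[set t : l.-tuple 'I_m | path r x t]|.

Lemma npaths_lenS l x : npaths_len l.+1 x = \sum_(z | r x z) npaths_len l z.
Proof.
rewrite /npaths_len -sum1_card (eq_bigl (fun t : l.+1.-tuple _ => path r x t));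
  last by move=> t; rewrite inE.
rewrite (reindex (fun p : 'I_m * l.-tuple 'I_m => cons_tuple p.1 p.2)) /=; last first.
  exists (fun t => (thead t, behead_tuple t)).
    by case=> z t _ /=; congr (_, _); apply: val_inj.
  by move=> t _; case/tupleP: t => z t; apply: val_inj; rewrite /= theadE.
rewrite -(pair_big_dep (r x) (fun z (t : l.-tuple 'I_m) => path r z t) (fun _ _ => 1)) /=.
by apply: eq_bigr => z _; rewrite -sum1_card; apply: eq_bigl => t; rewrite inE.
Qed.

Lemma npaths_from_acyclic x :
  acyclic_from x -> npaths_from r x = \sum_(l < m) npaths_len l x.
Proof.
move=> ax; apply: eq_bigr => l _; apply: eq_card => t; rewrite !inE.
by case: (boolP (path r x t)) => //= pt; have /= := acyclic_from_uniq ax pt.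
Qed.

Lemma npaths_len_acyclic0 x : acyclic_from x -> npaths_len m x = 0.
Proof.
move=> ax; apply/eqP; rewrite cards_eq0; apply/eqP/setP => t; rewrite !inE.
apply/negP => /(acyclic_from_uniq ax)/card_uniqP /= eqc.
have := max_card (mem (x :: t)); rewrite eqc card_ord size_tuple ltnn //.
Qed.

(** A path from [x] is the empty one or starts with an arrow to some [z]. The cut-off [l < m] is
    harmless in the shift of lengths, since a walk of length [m] would need [m + 1] distinct
    vertices. *)
Lemma npaths_from_rec x :
  acyclic_from x -> npaths_from r x = (\sum_(z | r x z) npaths_from r z).+1.
Proof.
move=> ax.
have m0 : 0 < m by apply: leq_ltn_trans (ltn_ord x).
rewrite npaths_from_acyclic //.
have -> : \sum_(z | r x z) npaths_from r z = \sum_(l < m) npaths_len l.+1 x.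
  rewrite (eq_bigr (fun z => \sum_(l < m) npaths_len l z)) => [|z xz]; last first.
    by rewrite npaths_from_acyclic //; apply: acyclic_from_step xz.
  by rewrite exchange_big; apply: eq_bigr => l _; rewrite npaths_lenS.
have len0 : npaths_len 0 x = 1.
  rewrite /npaths_len (eq_card (B := predT)); first by rewrite card_tuple expn0.
  by move=> t; rewrite !inE tuple0.
have := npaths_len_acyclic0 ax; move: m0 len0; move: (npaths_len^~ x).
case: (m) => // n f _ f0 fn.
rewrite big_ord_recl big_ord_recr /= f0 fn addn0 add1n; congr _.+1.
Qed.

Lemma count_sum_mem (P : pred 'I_m) w : count P w = \sum_(z | P z) count_mem z w.
Proof.
elim: w => [|a w IHw] /=; first by rewrite big1.
rewrite big_split /= -IHw; congr (_ + _).
case Pa: (P a); last first.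
  rewrite big1 // => z Pz; case: eqP => // az; by rewrite az Pz in Pa.
by rewrite (bigD1 a) //= eqxx big1 // => z /andP[_ /negbTE]; rewrite eq_sym => ->.
Qed.

(** By [spaced_count], [x] occurs at most once more than all its out-neighbours together, which
    matches the recursion for paths. The number of vertices reachable from [x] drops along
    arrows. *)
Lemma count_le_npaths w x :
  (forall y, spaced y (r y) false w) -> acyclic_from x ->
  count_mem x w <= npaths_from r x.
Proof.
move=> sp; have [n] := ubnP #|connect r x|; elim: n x => // n IHn x lt_n ax.
rewrite npaths_from_rec // -[count_mem x w]addn0.
apply: leq_trans (spaced_count (sp x)) _; rewrite ltnS count_sum_mem.
apply: leq_sum => z xz; apply: IHn; last exact: acyclic_from_step xz.
rewrite ltnS in lt_n; apply: leq_trans lt_n; apply: proper_card; apply/properP; split.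
  by apply/fintype.subsetP => y; rewrite !inE; apply: connect_trans (connect1 xz).
exists x; first by rewrite inE connect0.
by rewrite inE; apply: ax (connect0 r x) xz.
Qed.

(** A vertex of [D] reaching the most vertices is a source: an in-neighbour in [D] would reach
    strictly more. *)
Lemma exists_source (D : {set 'I_m}) :
  (forall x, x \in D -> acyclic_from x) -> 0 < #|D| ->
  exists2 x, x \in D & forall y, y \in D -> ~~ r y x.
Proof.
move=> aD /card_gt0P[x0 x0D].
case: (arg_maxnP (fun x => #|connect r x|) x0D) => x xD max_x.
exists x => // y yD; apply/negP => yx.
suff: #|connect r x| < #|connect r y| by rewrite ltnNge; case/negP; apply: max_x.
apply: proper_card; apply/properP; split.
  by apply/fintype.subsetP => z; rewrite !inE; apply: connect_trans (connect1 yx).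
exists y; first by rewrite inE connect0.
by rewrite inE; apply: (aD y yD) (connect0 r y) yx.
Qed.

(** The copies of [x] placed before [z] account for the paths beginning with the arrow to [z], the
    final copy for the empty path. *)
Definition add_source x w := flatten [seq if r x z then [:: x; z] else [:: z] | z <- w] ++ [:: x].

Lemma spaced_add_source x y (Y : pred 'I_m) w :
  y != x -> ~~ Y x -> spaced y Y false w -> spaced y Y false (add_source x w).
Proof.
move=> yx nYx; rewrite eq_sym in yx.
rewrite /add_source spaced_notin_cat; last by rewrite inE eq_sym.
elim: w false => //= z w IHw b.
by case: (r x z) => /=; rewrite ?(negbTE yx) ?nYx ?andbT; case: (z == y);
  by [case/andP=> -> /IHw | move/IHw].
Qed.

(** A source is removed, the rest is treated by induction, and the source is inserted by
    [add_source], which disturbs no other count or separation. In-neighbours of [x] are thus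
    inserted later than [x], each before every occurrence of [x]; hence any single one separates
    these occurrences. *)
Lemma exists_spaced_word (D : {set 'I_m}) :
  (forall x, x \in D -> acyclic_from x) ->
  (forall x y, x \in D -> r x y -> y \in D) ->
  exists w, [/\ forall x, x \in w -> x \in D,
    forall x, x \in D -> count_mem x w = npaths_from r x,
    forall x, x \in D -> spaced x (r x) false w &
    forall x y, x \in D -> y \in D -> r y x -> spaced x (pred1 y) false w].
Proof.
have [n] := ubnP #|D|; elim: n D => // n IHn D lt_n aD closedD.
have [/card0_eq D0|nD] := posnP #|D|.
  by exists [::]; split=> // x; rewrite D0.
have [x xD src] := exists_source aD nD.
have nrxx : ~~ r x x by apply: src.
have [|||w [wD countw spw spw']] := IHn (D :\ x).
- by rewrite (cardsD1 x) xD in lt_n.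
- by move=> y /setD1P[_ /aD].
- move=> y z /setD1P[_ yD] yz; rewrite !inE (closedD y) // andbT.
  by apply: contraTneq yz => ->; apply: src.
have nxw : x \notin w by apply/negP => /wD; rewrite !inE eqxx.
exists (add_source x w); split.
- move=> y; rewrite mem_cat inE => /orP[/flattenP[s /mapP[z /wD/setD1P[_ zD] ->]]|/eqP-> //].
  by case: ifP; rewrite !inE => _; [case/orP|] => /eqP->.
- move=> y yD; rewrite count_cat /= addn0.
  have [->|nyx] := eqVneq y x.
    rewrite npaths_from_rec; last exact: aD.
    rewrite -addn1; congr (_ + _).
    rewrite (eq_bigr (fun z => count_mem z w)) => [|z xz]; last first.
      rewrite countw // !inE (closedD x) // andbT.
      by apply: contraTneq xz => ->.
    rewrite -count_sum_mem; elim: w nxw {wD countw spw spw'} => //= z w IHw.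
    rewrite inE negb_or count_cat => /andP[nxz /IHw ->].
    by case: (r x z); rewrite /= eq_sym ?eqxx (negbTE nxz).
  rewrite addn0 -countw; last by rewrite !inE nyx.
  elim: w {wD countw spw spw' nxw} => //= z w IHw; rewrite count_cat IHw.
  by case: (r x z); rewrite /= ?addn0 // eq_sym (negbTE nyx).
- move=> y yD; have [->|nyx] := eqVneq y x; last first.
    by apply: spaced_add_source; rewrite ?src //; apply: spw; rewrite !inE nyx.
  rewrite /add_source; elim: w nxw {wD countw spw spw'} => [|z w IHw] /=.
    by rewrite eqxx.
  rewrite inE negb_or => /andP[nxz /IHw sp]; case xz: (r x z) => /=.
    by rewrite eqxx eq_sym (negbTE nxz) xz.
  by rewrite eq_sym (negbTE nxz).
- move=> y z yD zD zy; have nyx : y != x by apply: contraTneq zy => ->; apply: src.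
  have [eqzx|nzx] := eqVneq z x; last first.
    apply: spaced_add_source => //=; first by rewrite eq_sym.
    by apply: spw' => //; rewrite !inE ?nyx ?nzx.
  rewrite {z}eqzx in zD zy *.
  rewrite /add_source; elim: w {wD countw spw spw' nxw} false => [|z' w IHw] b /=.
    by rewrite eq_sym (negbTE nyx).
  case: ifP => xz' /=; last by case: eqP => // eqz; rewrite eqz zy in xz'.
  by rewrite eq_sym (negbTE nyx) eqxx andbF; case: eqP => // _; rewrite IHw.
Qed.

End PathCounting.

(** * Structure of the cycles *)

Section CycleStructure.
Variables (m : nat) (arr : rel 'I_m) (cs : seq (seq 'I_m)).
Hypothesis simple : simple_oriented arr.

Lemma is_cycle_path x p : path arr x p -> arr (last x p) x -> uniq (x :: p) ->
  is_cycle arr (x :: p).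
Proof.
case: p => [|y [|z p]] /= pth lst unq.
- by rewrite arr_irr in lst.
- by case/andP: pth => xy _; rewrite (arr_asym simple xy) in lst.
- by rewrite /is_cycle /= rcons_path /= lst andbT pth unq.
Qed.

Lemma is_cycle_rot c i : is_cycle arr c -> is_cycle arr (rot i c).
Proof. by rewrite /is_cycle size_rot rot_uniq rot_cycle. Qed.

Lemma is_cycle_connect c x y : is_cycle arr c -> x \in c -> y \in c -> connect arr x y.
Proof.
move=> cyc xc yc; have [i p def_c] := rot_to xc.
have := is_cycle_rot i cyc; rewrite def_c => /and3P[_ _].
rewrite /= rcons_path => /andP[pth _]; apply: (path_connect pth).
by rewrite -def_c mem_rot.
Qed.

Lemma on_cycle_back x y : arr x y -> connect arr y x -> on_cycle arr x.
Proof.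
move=> xy /connectP[p pth def_x]; exists (y :: shorten y p).
case: (shortenP pth) def_x => p' pth' uniq' _ def_x; split.
  by apply: is_cycle_path; rewrite -?def_x.
by rewrite def_x mem_last.
Qed.

Lemma connect_on_cycle x y :
  x != y -> connect arr x y -> connect arr y x -> on_cycle arr x.
Proof.
move=> neq /connectP[[|z p] /= pth def_y]; first by rewrite def_y eqxx in neq.
case/andP: pth => xz pth yx; apply: (on_cycle_back xz).
by apply: connect_trans yx; apply/connectP; exists p.
Qed.

Hypothesis nolink : no_linked_cycles arr.

(** Two cycles with [x] between them are linked, hence equal, and returning along this cycle closes
    a walk through [x]. *)
Lemma on_cycle_exclusive x : ~ on_cycle arr x ->
  ~ ((exists y, on_cycle arr y /\ connect arr x y) /\
     (exists z, on_cycle arr z /\ connect arr z x)).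
Proof.
move=> noc [[y [[c [cyc yc]] xy]] [z [[c' [cyc' zc]] zx]]]; apply: noc.
have [k eqc] := nolink cyc' cyc zc yc (connect_trans zx xy).
have [->|nxy] := eqVneq x y; first by exists c.
apply: (connect_on_cycle nxy xy); apply: connect_trans zx.
by apply: (is_cycle_connect cyc); rewrite // eqc mem_rot.
Qed.

Hypothesis enum_cs : cycle_enumeration arr cs.

Definition on_cs x := has (fun c => x \in c) cs.

Lemma cs_is_cycle c : c \in cs -> is_cycle arr c.
Proof. by case: enum_cs => + _ _ _; apply. Qed.

Lemma cs_uniq c : c \in cs -> uniq c.
Proof. by move/cs_is_cycle => /and3P[]. Qed.

Lemma on_csP x : reflect (on_cycle arr x) (on_cs x).
Proof.
apply: (iffP hasP) => [[c cin xc]|[c [cyc xc]]].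
  by exists c; split=> //; apply: cs_is_cycle.
case: enum_cs => _ /(_ c cyc)[c' c'in [i eqc]] _ _.
by exists c'; rewrite // -(mem_rot i) -eqc.
Qed.

Lemma on_csI c x : c \in cs -> x \in c -> on_cs x.
Proof. by move=> cin xc; apply/hasP; exists c. Qed.

Lemma cs_connect_eq c1 c2 x y :
  c1 \in cs -> c2 \in cs -> x \in c1 -> y \in c2 -> connect arr x y -> c1 = c2.
Proof.
move=> c1in c2in xc yc xy; case: enum_cs => _ _ _; apply=> //.
by apply: nolink xc yc xy; apply: cs_is_cycle.
Qed.

(** A chord into [z] would close a shorter cycle through [z], linked with [c] but not a rotation of
    it. *)
Lemma cs_chordless c y z :
  c \in cs -> y \in c -> z \in c -> arr y z -> y = prev c z.
Proof.
move=> cin yc zc yz; have cyc := cs_is_cycle cin.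
have [i p def_c] := rot_to zc.
suff key y' : y' \in c -> arr y' z -> y' = last z p.
  rewrite (key y) // (key (prev c z)) ?mem_prev //.
  by apply: prev_cycle => //; case/and3P: cyc.
move=> y'c y'z; have := is_cycle_rot i cyc; rewrite def_c => cycp.
have : y' \in z :: p by rewrite -def_c mem_rot.
rewrite inE => /orP[/eqP eqy|]; first by rewrite eqy arr_irr in y'z.
move=> y'p; case/splitPr: y'p def_c cycp => p1 p2 def_c cycp.
have cycp' : is_cycle arr (z :: rcons p1 y').
  case/and3P: cycp => _ + +; rewrite -cat_rcons /= rcons_cat cat_path.
  move=> /andP[nz unq] /andP[pth _]; apply: is_cycle_path => //.
    by rewrite last_rcons.
  move: nz unq; rewrite mem_cat negb_or cat_uniq => /andP[nz _] /andP[unq _].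
  by rewrite /= nz unq.
have [k eqr] := nolink cycp cycp' (mem_head _ _) (mem_head _ _) (connect0 arr z).
have := congr1 size eqr; rewrite size_rot /= size_rcons size_cat /=.
case: p2 {def_c cycp eqr} => [|a p2] /=; last by lia.
by rewrite cats1 last_rcons.
Qed.

Lemma cs_next c y z : c \in cs -> y \in c -> z \in c -> arr y z -> z = next c y.
Proof.
by move=> cin yc zc yz; rewrite (cs_chordless cin yc zc yz) next_prev // cs_uniq.
Qed.

Lemma cs_arr_next c y : c \in cs -> y \in c -> arr y (next c y).
Proof. by move=> cin yc; apply: next_cycle yc; case/and3P: (cs_is_cycle cin). Qed.

Lemma cs_arr_prev c y : c \in cs -> y \in c -> arr (prev c y) y.
Proof. by move=> cin yc; apply: prev_cycle yc; case/and3P: (cs_is_cycle cin). Qed.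

Lemma cs_adjacent_eq c1 c2 x y :
  c1 \in cs -> c2 \in cs -> x \in c1 -> y \in c2 -> adjacent arr x y -> c1 = c2.
Proof.
move=> c1in c2in xc yc /orP[/connect1 xy|/connect1 yx].
  exact: cs_connect_eq xy.
by apply/esym; apply: cs_connect_eq yx.
Qed.

Lemma cs_mem_eq c1 c2 x : c1 \in cs -> c2 \in cs -> x \in c1 -> x \in c2 -> c1 = c2.
Proof. by move=> c1in c2in xc1 xc2; apply: cs_connect_eq (connect0 arr x). Qed.

Lemma adjacent_attached c x y :
  c \in cs -> x \in c -> adjacent arr x y -> (y \in c) || (y \in attached arr c).
Proof.
move=> cin xc xy; case: (boolP (y \in c)) => //= yc; rewrite inE yc.
by apply/hasP; exists x; rewrite // orbC.
Qed.

Lemma attachedP c x : x \in attached arr c -> exists2 y, y \in c & adjacent arr x y.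
Proof. by rewrite inE => /andP[_ /hasP[y yc xy]]; exists y. Qed.

Lemma attached_off c x : c \in cs -> x \in attached arr c -> ~~ on_cs x.
Proof.
move=> cin xA; have [y yc xy] := attachedP xA; apply/negP => /hasP[c' c'in xc'].
by move: xA; rewrite inE -(cs_adjacent_eq c'in cin xc' yc xy) xc'.
Qed.

Definition downstream : {set 'I_m} :=
  [set x | ~~ on_cs x && [exists y, on_cs y && connect arr y x]].

Definition upstream : {set 'I_m} :=
  [set x | ~~ on_cs x && [exists y, on_cs y && connect arr x y]].

Lemma downstreamP x :
  reflect (~~ on_cs x /\ exists2 y, on_cs y & connect arr y x) (x \in downstream).
Proof.
rewrite inE; apply: (iffP andP) => -[nx]; first by case/existsP=> y /andP[]; split; last exists y.
by case=> y yc yx; split=> //; apply/existsP; exists y; rewrite yc.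
Qed.

Lemma upstreamP x :
  reflect (~~ on_cs x /\ exists2 y, on_cs y & connect arr x y) (x \in upstream).
Proof.
rewrite inE; apply: (iffP andP) => -[nx]; first by case/existsP=> y /andP[]; split; last exists y.
by case=> y yc yx; split=> //; apply/existsP; exists y; rewrite yc.
Qed.

Lemma not_between x y z :
  ~~ on_cs x -> on_cs y -> on_cs z -> connect arr y x -> connect arr x z -> False.
Proof.
move=> /on_csP nx /on_csP yc /on_csP zc yx xz.
by case: (on_cycle_exclusive nx); split; [exists z | exists y].
Qed.

Lemma downstream_upstream x : x \in downstream -> x \in upstream -> False.
Proof.
by case/downstreamP=> nx [y yc yx] /upstreamP[_ [z zc xz]]; apply: not_between yx xz.
Qed.

Lemma connect_rev_rel x y : connect (rev_rel arr) x y = connect arr y x.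
Proof. exact: connect_rev. Qed.

(** A closed walk reachable from [x] contains a cycle vertex, and [x] would lie between two
    cycles. *)
Lemma acyclic_downstream x : x \in downstream -> acyclic_from arr x.
Proof.
case/downstreamP=> nx [y yc yx] z t xz zt; apply/negP => tz.
have zc : on_cs z by apply/on_csP; apply: on_cycle_back zt tz.
exact: not_between yx xz.
Qed.

(** This also covers vertices joined to no cycle, whose occurrences are bounded through the reversed
    graph. *)
Lemma acyclic_not_downstream x :
  ~~ on_cs x -> x \notin downstream -> acyclic_from (rev_rel arr) x.
Proof.
move=> nx nd z t; rewrite connect_rev_rel => xz tz; rewrite connect_rev_rel.
apply: contra nd => zt; apply/downstreamP; split=> //; exists t.
  by apply/on_csP; apply: on_cycle_back tz zt.
exact: connect_trans (@connect1 _ arr t z tz) xz.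
Qed.

Lemma acyclic_upstream x : x \in upstream -> acyclic_from (rev_rel arr) x.
Proof.
move=> xu; apply: acyclic_not_downstream; first by case/upstreamP: xu.
by apply/negP => xd; apply: downstream_upstream xd xu.
Qed.

Lemma downstream_closed x y : x \in downstream -> arr x y -> y \in downstream.
Proof.
case/downstreamP=> nx [z zc zx] xy; apply/downstreamP; split; last first.
  by exists z => //; apply: connect_trans zx (connect1 xy).
by apply/negP => yc; apply: not_between zx (connect1 xy).
Qed.

Lemma upstream_closed x y : x \in upstream -> rev_rel arr x y -> y \in upstream.
Proof.
case/upstreamP=> nx [z zc xz] yx; apply/upstreamP; split; last first.
  by exists z => //; apply: connect_trans (@connect1 _ arr y x yx) xz.
by apply/negP => yc; apply: not_between (@connect1 _ arr y x yx) xz.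
Qed.

(** Supplies the in-neighbour that will separate the occurrences of [x] in the words of the lower
    bound. *)
Lemma downstream_pred x : x \in downstream ->
  exists2 y, arr y x & on_cs y || (y \in downstream).
Proof.
case/downstreamP=> nx [z zc zx].
case/connectP: zx => p; elim/last_ind: p => [_ /= eqx|p y _].
  by rewrite eqx zc in nx.
rewrite rcons_path last_rcons => /andP[pth lst] ->; exists (last z p) => //.
apply/orP; case: (boolP (on_cs _)) => noc; [by left | right].
by apply/downstreamP; split=> //; exists z => //; apply/connectP; exists p.
Qed.

Lemma upstream_succ x : x \in upstream ->
  exists2 y, arr x y & on_cs y || (y \in upstream).
Proof.
case/upstreamP=> nx [z zc /connectP[[|y p] /= pth def_z]].
  by rewrite -def_z zc in nx.
case/andP: pth => xy pth; exists y => //.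
apply/orP; case: (boolP (on_cs y)) => noc; [by left | right].
by apply/upstreamP; split=> //; exists z => //; apply/connectP; exists p.
Qed.

(** The test in [k_x] refers to one cycle, but its outcome depends on [x] alone: [x] is joined to
    [c] by an arrow and cannot lie between cycles. *)
Lemma attached_downstream c x :
  c \in cs -> x \in attached arr c ->
  has (fun y => connect arr y x) c = (x \in downstream).
Proof.
move=> cin xA; have nx := attached_off cin xA; apply/hasP/idP => [[y yc yx]|xd].
  by apply/downstreamP; split=> //; exists y => //; apply: on_csI yc.
have [y yc /orP[xy|yx]] := attachedP xA; last by exists y => //; apply: connect1.
case: (downstream_upstream xd); apply/upstreamP; split=> //.
by exists y; [apply: on_csI yc | apply: connect1].
Qed.

Lemma attached_upstream c x :
  c \in cs -> x \in attached arr c -> x \notin downstream -> x \in upstream.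
Proof.
move=> cin xA nd; have nx := attached_off cin xA.
have [y yc /orP[xy|yx]] := attachedP xA.
  by apply/upstreamP; split=> //; exists y; [apply: on_csI yc | apply: connect1].
case/negP: nd; apply/downstreamP; split=> //.
by exists y; [apply: on_csI yc | apply: connect1].
Qed.

Lemma k_x_attached c x : c \in cs -> x \in attached arr c ->
  k_x arr c x = if x \in downstream then npaths_from arr x
                else npaths_from (rev_rel arr) x.
Proof. by move=> cin xA; rewrite /k_x attached_downstream. Qed.

End CycleStructure.

(** * Segments of cycle letters *)

Section Segments.
Variables (T : eqType) (P Q : pred T).
Implicit Types (w : seq T) (i : nat) (S : pred T).

(* The letters of [Q] between the [i]-th and the next letter of [P], the letters
   of [P] being counted from [1]. *)
Fixpoint segment i w : seq T :=
  if w is a :: w' then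
    if P a then (if i is i'.+1 then segment i' w' else [::])
    else if (i == 0) && Q a then a :: segment i w' else segment i w'
  else [::].

Fixpoint assemble S (ps : seq T) (g : nat -> seq T) : seq T :=
  g 0 ++ (if ps is a :: ps' then nseq (S a) a ++ assemble S ps' (fun i => g i.+1)
          else [::]).

Lemma eq_assemble S ps g g' :
  (forall i, i <= size ps -> g i = g' i) -> assemble S ps g = assemble S ps g'.
Proof.
elim: ps g g' => [|a ps IHps] g g' eqg /=; rewrite eqg //.
by congr (_ ++ (_ ++ _)); apply: IHps => i lei; apply: eqg.
Qed.

(** A projection onto letters of [P] and [Q] can thus be recovered from the subword of [P]-letters
    and the projected segments. *)
Lemma filter_assemble S w : (forall a, S a -> P a || Q a) ->
  filter S w = assemble S (filter P w) (fun i => filter S (segment i w)).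
Proof.
move=> SPQ; elim: w => //= a w IHw; case: (boolP (P a)) => Pa /=.
  by rewrite IHw; case: (S a).
case: (boolP (S a)) => Sa.
  have := SPQ a Sa; rewrite (negbTE Pa) /= => Qa; rewrite Qa IHw.
  by case: (filter P w) => [|b ps] /=; rewrite ?Sa.
rewrite IHw; apply: eq_assemble => i _; case: i => //=.
by case: (Q a); rewrite //= (negbTE Sa).
Qed.

Lemma segment_all i w : all Q (segment i w).
Proof.
elim: w i => //= a w IHw i; case: (P a); first by case: i.
by case: (Q a) / boolP => Qa; case: i => [|i] //=; rewrite ?Qa IHw.
Qed.

Lemma size_segment i w : size (segment i w) <= size w.
Proof.
elim: w i => //= a w IHw i; case: (P a).
  by case: i => // i; apply: leq_trans (IHw i) _.
by case: ifP => _; [rewrite ltnS | apply: leq_trans (IHw i) _].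
Qed.

(** Letters dropped inside a segment are not in [Y]. Only segment [0] starts where [w] does and
    inherits the flag; for the others it may be cleared. *)
Lemma spaced_segment x (Y : pred T) b i w :
  Q x -> ~~ P x -> (forall a, Y a -> P a || Q a) ->
  spaced x Y b w -> spaced x Y (b && (i == 0)) (segment i w).
Proof.
move=> Qx nPx YPQ; elim: w b i => //= a w IHw b i.
have [->|nax] := eqVneq a x.
  case/andP=> nb /IHw sp; rewrite (negbTE nPx) Qx (negbTE nb) andbT.
  by case: i => [|i] /=; [rewrite eqxx; apply: (sp 0) | have := sp i.+1; rewrite andbF].
move=> /IHw sp; case: (boolP (P a)) => Pa.
  case: i => // i; apply: spaced_sub (sp i) => //; by rewrite andbF.
case: i => [|i] /=; last by have := sp i.+1; rewrite !andbF.
case: (boolP (Q a)) => Qa /=.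
  by rewrite (negbTE nax); have := sp 0; rewrite !andbT.
have nYa : ~~ Y a by apply/negP => /YPQ; rewrite (negbTE Pa) (negbTE Qa).
by have := sp 0; rewrite nYa !andbT.
Qed.

End Segments.

(** * Alternation of two mutually separating letters *)

Section Alternation.
Variable T : eqType.
Implicit Types (y z : T) (s : seq T).

Fixpoint alternate y z n := if n is n'.+1 then y :: alternate z y n' else [::].

Lemma filter_pred2C y z s : filter (pred2 y z) s = filter (pred2 z y) s.
Proof. by apply: eq_filter => a /=; rewrite orbC. Qed.

Lemma spaced_alternate_flagged y z s : y != z ->
  spaced y (pred1 z) true s -> spaced z (pred1 y) false s ->
  filter (pred2 y z) s = alternate z y (size (filter (pred2 y z) s)).
Proof.
elim: s y z => //= a s IHs y z nyz; have [-> //|nay] := eqVneq a y.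
have [->|naz] /= := eqVneq a z; last exact: IHs.
by rewrite filter_pred2C => sz sy; congr (_ :: _); apply: IHs; rewrite // eq_sym.
Qed.

(** The first letter and the length determine an alternating word; the empty one falls under the
    second branch. *)
Lemma spaced_alternate y z s : y != z ->
  spaced y (pred1 z) false s -> spaced z (pred1 y) false s ->
  filter (pred2 y z) s =
  if ohead (filter (pred2 y z) s) == Some y
  then alternate y z (size (filter (pred2 y z) s))
  else alternate z y (size (filter (pred2 y z) s)).
Proof.
move=> nyz; elim: s => [|a s IHs] //.
rewrite /=; have [->|nay] /= := eqVneq a y.
  rewrite (inj_eq Some_inj) eqxx (negbTE nyz) /= => sy sz; congr (_ :: _).
  exact: spaced_alternate_flagged.
have [->|naz] /= := eqVneq a z; last exact: IHs.
rewrite (inj_eq Some_inj) eq_sym (negbTE nyz) => sy sz; congr (_ :: _).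
by rewrite filter_pred2C; apply: spaced_alternate_flagged; rewrite // eq_sym.
Qed.

End Alternation.

(** * Coding of words on a single cycle *)

Section CycleWordCode.
Variables (m : nat) (arr : rel 'I_m) (c : seq 'I_m).
Hypothesis uniq_c : uniq c.

Definition base_count (s : seq 'I_m) := count (fun z => ohead c == Some z) s.

Definition cycle_spaced (s : seq 'I_m) := forall x, x \in c ->
  spaced x (pred1 (next c x)) false s /\ spaced x (pred1 (prev c x)) false s.

(** Consecutive vertices of the cycle separate each other, so their counts differ by at most one;
    the deviation adds up along at most [m] steps. *)
Lemma count_near_base s y : cycle_spaced s -> y \in c ->
  (count_mem y s <= base_count s + m) /\ (base_count s <= count_mem y s + m).
Proof.
move=> sp yc; have lem : size c <= m.
  by rewrite -(card_uniqP uniq_c) -[m in _ <= m]card_ord max_card.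
have [x0 [p def_c]] : exists x0 p, c = x0 :: p.
  by case: c yc => // x0 p _; exists x0, p.
have -> : base_count s = count_mem x0 s.
  by rewrite /base_count def_c; apply: eq_count => z /=; rewrite eq_sym.
pose e := [rel x z | (count_mem x s <= (count_mem z s).+1) && (count_mem z s <= (count_mem x s).+1)].
have pth : path e x0 p.
  have := cycle_next uniq_c; rewrite {2}def_c /= rcons_path => /andP[pth _].
  apply: (@sub_in_path _ (mem c)) pth; last by apply/allP => z; rewrite /= def_c.
  move=> x z xc zc /eqP eqz /=.
  have [sx _] := sp x xc; have [_ sz] := sp z zc.
  have := spaced_count sx; have := spaced_count sz.
  rewrite eqz -[in prev c z]eqz prev_next // !addn0.
  by move=> -> ->.
rewrite def_c /= in lem.
suff : count_mem y s <= count_mem x0 s + size p /\ count_mem x0 s <= count_mem y s + size p.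
  by case=> h1 h2; split; lia.
move: pth yc; rewrite def_c; elim: p x0 {def_c lem} => [|z p IHp] x0 /=.
  by rewrite inE => _ /eqP ->; rewrite addn0.
case/andP=> /andP[h1 h2] /IHp IH; rewrite inE => /orP[/eqP ->|/IH[h3 h4]].
  by rewrite leq_addr.
split; first by apply: leq_trans h3 _; rewrite addnS -addSn leq_add2r.
by apply: leq_trans h1 _; rewrite addnS ltnS.
Qed.

(** Only the first component ranges over a set growing with [N]. The second is the deviation from
    it, shifted by [m] to be nonnegative; the third tells which of two letters comes first. *)
Definition cycle_code N (s : seq 'I_m) :
    'I_N.+1 * {ffun 'I_m -> 'I_(m + m).+1} * {ffun 'I_m * 'I_m -> bool} :=
  (inord (base_count s), [ffun y => inord (count_mem y s + m - base_count s)],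
   [ffun p : 'I_m * 'I_m => ohead (filter (pred2 p.1 p.2) s) == Some p.1]).

Lemma size_filter_pred2 (a b : 'I_m) s :
  size (filter (pred2 a b) s) = if a == b then count_mem a s else count_mem a s + count_mem b s.
Proof.
rewrite size_filter; have [<-|nab] := eqVneq a b.
  by apply: eq_count => z /=; rewrite orbb.
rewrite -count_predUI [X in _ = _ + X](eq_count (a2 := pred0)) ?count_pred0 ?addn0 //.
by move=> z /=; case: eqP => // ->; rewrite (negbTE nab).
Qed.

Lemma cycle_code_inj N s s' : cycle_spaced s -> cycle_spaced s' ->
  size s <= N -> size s' <= N -> cycle_code N s = cycle_code N s' ->
  forall y, y \in c ->
    filter (pred2 y y) s = filter (pred2 y y) s' /\
    (y != next c y -> filter (pred2 y (next c y)) s = filter (pred2 y (next c y)) s').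
Proof.
move=> sp sp' sz sz' [/(congr1 val) eqb /ffunP eqc /ffunP eqh].
have lt_b t : size t <= N -> base_count t < N.+1 by rewrite ltnS; apply: leq_trans; apply: count_size.
rewrite /= !inordK ?lt_b // in eqb.
have eq_count y : y \in c -> count_mem y s = count_mem y s'.
  move=> yc; have := congr1 val (eqc y); rewrite !ffunE /=.
  have [h1 h2] := count_near_base sp yc; have [h3 h4] := count_near_base sp' yc.
  move: h1 h2 h3 h4 eqb.
  move: (count_mem y s) (count_mem y s') (base_count s) (base_count s') => a a' b b'.
  by move=> h1 h2 h3 h4 eqb; rewrite !inordK; lia.
move=> y yc; have nc : next c y \in c by rewrite mem_next.
have eqy : filter (pred2 y y) s = filter (pred2 y y) s'.
  have nseqE t : filter (pred2 y y) t = nseq (count_mem y t) y.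
    by elim: t => //= a t ->; case: eqP => //= ->.
  by rewrite !nseqE eq_count.
split=> // nyn; have [s1 _] := sp y yc; have [_ s2] := sp _ nc.
have [s1' _] := sp' y yc; have [_ s2'] := sp' _ nc; rewrite prev_next // in s2 s2'.
rewrite (spaced_alternate nyn s1 s2) (spaced_alternate nyn s1' s2').
have := eqh (y, next c y); rewrite !ffunE /= => ->.
by rewrite !size_filter_pred2 !eq_count.
Qed.

End CycleWordCode.

(** * Upper bound *)

Section UpperBound.
Variables (m : nat) (arr : rel 'I_m) (cs : seq (seq 'I_m)).
Hypothesis simple : simple_oriented arr.
Hypothesis nolink : no_linked_cycles arr.
Hypothesis enum_cs : cycle_enumeration arr cs.

Definition nseg c := (\sum_(x in attached arr c) k_x arr c x + 1)%N.

Definition seg_index := {j : 'I_(size cs) & 'I_(nseg (nth [::] cs j))}.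

Lemma card_seg_index : #|{: seg_index}| = \sum_(c <- cs) nseg c.
Proof.
rewrite card_tagged sumnE big_map big_enum /= (big_nth [::]) big_mkord.
by apply: eq_bigr => j _; rewrite card_ord.
Qed.

Definition cycle_segment c := segment [in attached arr c] [in c].

Definition occ_bound := \sum_(x : 'I_m) (npaths_from arr x + npaths_from (rev_rel arr) x).

Lemma reduced_count w x : reduced arr w -> ~~ on_cs cs x ->
  count_mem x w <= if x \in downstream arr cs then npaths_from arr x
                   else npaths_from (rev_rel arr) x.
Proof.
move=> /reducedP red nx; case: (boolP (x \in downstream arr cs)) => xd.
  apply: count_le_npaths => [y|]; first by case: (red y).
  exact: (acyclic_downstream simple nolink enum_cs).
apply: count_le_npaths => [y|]; first by case: (red y).
exact: (acyclic_not_downstream simple enum_cs).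
Qed.

Lemma reduced_off_size w : reduced arr w -> size (filter (predC (on_cs cs)) w) <= occ_bound.
Proof.
move=> red; rewrite size_filter count_sum_mem big_mkcond; apply: leq_sum => x _ /=.
case: ifP => // nx; apply: leq_trans (reduced_count red nx) _.
by case: ifP => _; rewrite ?leq_addr ?leq_addl.
Qed.

Lemma reduced_attached_count c w : c \in cs -> reduced arr w ->
  count [in attached arr c] w < nseg c.
Proof.
move=> cin red; rewrite /nseg addn1 ltnS count_sum_mem; apply: leq_sum => x xA.
rewrite (k_x_attached simple nolink enum_cs cin xA).
exact: reduced_count red (attached_off nolink enum_cs cin xA).
Qed.

(** Neighbours of [x] are attached to [c] or lie on it. Inside a segment only the latter remain, and
    as [c] has no chords they are the next and the previous vertex. *)
Lemma segment_cycle_spaced c i w : c \in cs -> reduced arr w ->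
  cycle_spaced c (cycle_segment c i w).
Proof.
move=> cin /reducedP red x xc; have [sp1 sp2] := red x.
have nxA : ~~ [in attached arr c] x by rewrite /= inE xc.
have adjPQ a : adjacent arr x a -> [in attached arr c] a || [in c] a.
  by move=> xa; rewrite orbC (adjacent_attached cin xc xa).
have in_c a : a \in cycle_segment c i w -> a \in c by move/(allP (segment_all _ _ _ _)).
split.
  have := spaced_segment i xc nxA (fun a xa => adjPQ a (introT orP (or_introl xa))) sp1.
  by apply: spaced_sub => // a /in_c ac xa; apply/eqP; apply: (cs_next simple nolink enum_cs).
have := spaced_segment i xc nxA (fun a xa => adjPQ a (introT orP (or_intror xa))) sp2.
by apply: spaced_sub => // a /in_c ac xa; apply/eqP; apply: (cs_chordless simple nolink enum_cs).
Qed.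

(** The off-cycle subword has bounded length and contributes a constant factor to the count; each
    segment contributes a factor linear in [N]. *)
Definition word_code N w :=
  (insub_bseq occ_bound (filter (predC (on_cs cs)) w),
   [ffun p : seg_index => let c := nth [::] cs (tag p) in
     cycle_code c N (cycle_segment c (tagged p) w)]).

(** A pair of off-cycle letters is seen in the off-cycle subword. Otherwise one letter lies on some
    [c] and the other is on [c] or attached to it, so that the projection is assembled from attached
    letters and coded segments. *)
Lemma word_code_inj N w w' : reduced arr w -> reduced arr w' ->
  size w <= N -> size w' <= N -> word_code N w = word_code N w' ->
  same_projections arr w w'.
Proof.
move=> red red' sz sz' [/(congr1 val) eq_off /ffunP eq_seg].
rewrite /= /insub_bseq !insubdK in eq_off; try exact: reduced_off_size.
have off_sub (S : pred 'I_m) : (forall a, S a -> ~~ on_cs cs a) ->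
    filter S w = filter S w'.
  move=> Soff; have eqS v : filter S v = filter S (filter (predC (on_cs cs)) v).
    rewrite -filter_predI; apply: eq_filter => a /=.
    by case: (boolP (S a)) => //= /Soff ->.
  by rewrite eqS eq_off -eqS.
have on_c c z y : c \in cs -> z \in c -> (z == y) || adjacent arr z y ->
    filter (pred2 z y) w = filter (pred2 z y) w'.
  move=> cin zc zy.
  have eqA : filter [in attached arr c] w = filter [in attached arr c] w'.
    by apply: off_sub => a; apply: attached_off.
  have SPQ a : pred2 z y a -> [in attached arr c] a || [in c] a.
    case/orP=> /eqP ->; first by rewrite /= zc orbT.
    case/orP: zy => [/eqP <-|zy]; first by rewrite /= zc orbT.
    by rewrite orbC; apply: (adjacent_attached cin zc zy).
  rewrite (filter_assemble _ SPQ) (filter_assemble _ SPQ) eqA.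
  apply: eq_assemble => i; rewrite -eqA size_filter => lei.
  have jlt : index c cs < size cs by rewrite index_mem.
  have cE : nth [::] cs (index c cs) = c by rewrite nth_index.
  have ilt : i < nseg (nth [::] cs (Ordinal jlt)).
    by rewrite /= cE; apply: leq_ltn_trans lei (reduced_attached_count cin red).
  have := eq_seg (existT _ (Ordinal jlt) (Ordinal ilt)); rewrite !ffunE /= cE => eq_code.
  have sp := segment_cycle_spaced i cin red.
  have sp' := segment_cycle_spaced i cin red'.
  have szs v : size v <= N -> size (cycle_segment c i v) <= N.
    by apply: leq_trans; apply: size_segment.
  have key := cycle_code_inj (cs_uniq enum_cs cin) sp sp' (szs _ sz) (szs _ sz') eq_code.
  (* A [y] off the cycle does not occur in the segments, where the projection only counts [z]. *)
  case: (boolP (y \in c)) => yc; last first.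
    have eqz v : filter (pred2 z y) (cycle_segment c i v) =
                 filter (pred2 z z) (cycle_segment c i v).
      apply: eq_in_filter => a /(allP (segment_all _ _ _ _)) /= ac.
      by rewrite orbb [a == y](negbTE (memPn yc a ac)) ?orbF.
    by rewrite -/(cycle_segment c) !eqz; case: (key z zc).
  rewrite -/(cycle_segment c); case/orP: zy => [/eqP <-|]; first by case: (key z zc).
  have neq a b : arr a b -> a != b.
    by move=> ab; apply: contraTneq ab => ->; rewrite arr_irr.
  case/orP=> [zy|yz].
    have eqy := cs_next simple nolink enum_cs cin zc yc zy.
    by rewrite eqy; case: (key z zc) => _; apply; rewrite -eqy neq.
  have eqz := cs_next simple nolink enum_cs cin yc zc yz.
  rewrite ![filter (pred2 z y) _]filter_pred2C eqz.
  by case: (key y yc) => _; apply; rewrite -eqz neq.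
move=> a b ab; case: (boolP (on_cs cs a)) => [/hasP[c cin ac]|na]; first exact: on_c ac ab.
case: (boolP (on_cs cs b)) => [/hasP[c cin bc]|nb].
  rewrite ![filter (pred2 a b) _]filter_pred2C; apply: on_c bc _ => //.
  by rewrite eq_sym adjacentC.
by apply: off_sub => z /orP[] /eqP ->.
Qed.

Lemma dim_VN_upper (K : fieldType) :
  exists C, forall N, dim_VN K arr N <= C * N.+1 ^ (\sum_(c <- cs) nseg c).
Proof.
pose rep w := sval (cid (exists_reduced arr w)).
have repP w : [/\ hk_eq arr w (rep w), size (rep w) <= size w & reduced arr (rep w)].
  by rewrite /rep; case: cid.
(* The number of off-cycle subwords, times the bounded data of every segment. *)
exists (#|{: occ_bound.-bseq 'I_m}| *
  (#|{: {ffun 'I_m -> 'I_(m + m).+1}}| * #|{: {ffun 'I_m * 'I_m -> bool}}|) ^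
    (\sum_(c <- cs) nseg c)) => N.
have code_inj u v : size u <= N -> size v <= N ->
    word_code N (rep u) = word_code N (rep v) -> hk_eq arr u v.
  have [hu su ru] := repP u; have [hv sv rv] := repP v => uN vN eqc.
  apply: hk_eq_trans hu _; apply: hk_eq_trans (hk_eqC hv).
  apply: same_projections_hk; apply: word_code_inj eqc => //.
    exact: leq_trans su uN.
  exact: leq_trans sv vN.
apply: leq_trans (dim_VN_le K code_inj) _.
rewrite card_prod card_ffun card_seg_index -mulnA leq_mul2l -expnMn !card_prod card_ord.
by apply/orP; right; rewrite -[in leqLHS]mulnA [N.+1 * _]mulnC.
Qed.

End UpperBound.

(** * Lower bound *)

Section LowerBound.
Variables (m : nat) (arr : rel 'I_m) (cs : seq (seq 'I_m)).
Hypothesis simple : simple_oriented arr.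
Hypothesis nolink : no_linked_cycles arr.
Hypothesis enum_cs : cycle_enumeration arr cs.

Local Notation attached := (attached arr).
Local Notation on_cs := (on_cs cs).

(** In the first case the separating neighbour lies on a cycle and is supplied by the power of that
    cycle inserted before each [x]. *)
Definition well_spaced_separators (r : rel 'I_m) L := forall x, x \in L ->
  (exists c y, [/\ c \in cs, y \in c & r x y]) \/ spaced x (r x) false L.

(** The word for the upstream vertices, built in the reversed graph, is followed by the one for the
    downstream vertices. Separation on one side holds by construction; on the other a single
    neighbour suffices, on a cycle or in the same part. *)
Lemma exists_separators : exists L : seq 'I_m,
  [/\ forall x, x \in L -> ~~ on_cs x,
      forall c, c \in cs -> (count [in attached c] L).+1 = nseg arr c,
      well_spaced_separators arr L & well_spaced_separators (rev_rel arr) L].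
Proof.
have [P [Pd Pcount Psp Psp']] := exists_spaced_word (acyclic_downstream simple nolink enum_cs)
  (downstream_closed simple nolink enum_cs).
have [M [Mu Mcount Msp Msp']] := exists_spaced_word (acyclic_upstream simple nolink enum_cs)
  (upstream_closed simple nolink enum_cs).
have PM x : x \in P -> x \notin M.
  by move=> /Pd xd; apply/negP => /Mu; apply: (downstream_upstream simple nolink enum_cs xd).
have MP x : x \in M -> x \notin P by move=> xM; apply/negP => /PM; rewrite xM.
exists (M ++ P); split.
- by move=> x; rewrite mem_cat => /orP[/Mu/upstreamP[]|/Pd/downstreamP[]].
- move=> c cin; rewrite count_sum_mem /nseg addn1; congr _.+1; apply: eq_bigr => x xA.
  rewrite (k_x_attached simple nolink enum_cs cin xA) count_cat.
  case: (boolP (x \in downstream arr cs)) => xd.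
    rewrite Pcount // (count_memPn _) //; apply/negP => /Mu; apply: (downstream_upstream simple nolink enum_cs xd).
  rewrite Mcount; last exact: (attached_upstream nolink enum_cs cin xA xd).
  by rewrite [count_mem x P](count_memPn _) ?addn0 //; apply/negP => /Pd; rewrite (negbTE xd).
- move=> x; rewrite mem_cat => /orP[xM|xP]; last first.
    by right; rewrite spaced_cat_notin ?PM //; apply/Psp/Pd.
  have [y xy /orP[/hasP[c cin yc]|yu]] := upstream_succ (Mu x xM).
    by left; exists c, y.
  right; rewrite spaced_notin_cat ?MP //.
  apply: spaced_sub (Msp' x y (Mu x xM) yu xy) => // a _ /eqP ->; exact: xy.
- move=> x; rewrite mem_cat => /orP[xM|xP].
    by right; rewrite spaced_notin_cat ?MP //; apply/Msp/Mu.
  have [y yx /orP[/hasP[c cin yc]|yd]] := downstream_pred (Pd x xP).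
    by left; exists c, y.
  right; rewrite spaced_cat_notin ?PM //.
  apply: spaced_sub (Psp' x y (Pd x xP) yd yx) => // a _ /eqP ->; exact: yx.
Qed.

Definition rounds (c : seq 'I_m) n := flatten (nseq n c).

(** The successor ensures that every vertex of a selected cycle occurs and can serve as a
    separator. *)
Definition block (sel : pred (seq 'I_m)) (e : seq 'I_m -> nat -> nat) :=
  flatten [seq rounds c (e c 0).+1 | c <- cs & sel c].

(** [e c i] governs the power of [c] in its own [i]-th segment, so a separator shifts the index only
    for the cycles it is attached to. *)
Fixpoint build L e : seq 'I_m :=
  if L is x :: L' then
    block (fun c => x \in attached c) e ++
    x :: build L' (fun c => if x \in attached c then fun i => e c i.+1 else e c)
  else block predT e.

Lemma size_rounds c n : size (rounds c n) = n * size c.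
Proof. by elim: n => //= n IHn; rewrite size_cat IHn. Qed.

Lemma roundsD c n p : rounds c n ++ rounds c p = rounds c (n + p).
Proof. by rewrite /rounds -flatten_cat nseqD. Qed.

Lemma filter_rounds (S : pred 'I_m) c n : filter S (rounds c n) = rounds (filter S c) n.
Proof. by rewrite /rounds filter_flatten map_nseq. Qed.

Lemma mem_rounds c n x : x \in rounds c n -> x \in c.
Proof. by case/flattenP => s; rewrite mem_nseq => /andP[_ /eqP ->]. Qed.

Lemma mem_block sel e x : x \in block sel e -> on_cs x.
Proof.
case/flattenP => s /mapP[c]; rewrite mem_filter => /andP[_ cin] -> /mem_rounds xc.
exact: on_csI xc.
Qed.

Lemma block_mem (sel : pred (seq 'I_m)) e c x : c \in cs -> sel c -> x \in c -> x \in block sel e.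
Proof.
move=> cin selc xc; apply/flattenP; exists (rounds c (e c 0).+1).
  by apply/mapP; exists c; rewrite // mem_filter selc.
by rewrite mem_cat xc.
Qed.

Lemma filter_block (S : pred 'I_m) sel e c : c \in cs ->
  (forall a, S a -> on_cs a -> a \in c) ->
  filter S (block sel e) = if sel c then rounds (filter S c) (e c 0).+1 else [::].
Proof.
move=> cin Sc; rewrite /block filter_flatten -map_comp.
have others c' : c' \in cs -> c' != c -> filter S (rounds c' (e c' 0).+1) = [::].
  move=> c'in ncc; apply/eqP; rewrite -size_eq0 size_filter -leqn0 leqNgt -has_count.
  apply/hasPn => a /mem_rounds ac'; apply/negP => Sa; case/eqP: ncc.
  apply: (cs_mem_eq nolink enum_cs c'in cin ac'); apply: Sc => //; exact: on_csI ac'.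
have [_ _ uniq_cs _] := enum_cs.
elim: (cs) (cin) (uniq_cs) others => //= c' s IHs; rewrite inE.
have [<- _ /andP[ncs _] others|ncc /= cs' /andP[nc's us] others] := eqVneq c c'.
  suff tl : flatten [seq (filter S \o (fun c => rounds c (e c 0).+1)) i | i <- s & sel i] = [::].
    by case: (sel c) => /=; rewrite tl ?cats0 ?filter_rounds.
  elim: s ncs others {IHs} => //= c1 s IHs; rewrite inE negb_or => /andP[n1 ns] others.
  have tl := IHs ns; case: (sel c1) => /=; last first.
    by apply: tl => d; rewrite inE => /orP[/eqP->|ds]; apply: others; rewrite !inE ?eqxx ?ds ?orbT.
  rewrite others ?inE ?eqxx ?orbT // 1?eq_sym //=.
  by apply: tl => d; rewrite inE => /orP[/eqP->|ds]; apply: others; rewrite !inE ?eqxx ?ds ?orbT.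
have IH := IHs cs' us (fun d ds => others d (introT orP (or_intror ds))).
case: (sel c') => //=; rewrite others ?inE ?eqxx // eq_sym //.
Qed.

Lemma mem_build L e x : x \in build L e -> on_cs x || (x \in L).
Proof.
elim: L e => [|y L IHL] e /=; first by move/mem_block->.
rewrite mem_cat !inE => /orP[/mem_block->//|/orP[->|/IHL/orP[->|->]]]; by rewrite ?orbT.
Qed.

Lemma filter_build_off (S : pred 'I_m) L e :
  (forall a, S a -> ~~ on_cs a) -> filter S (build L e) = filter S L.
Proof.
move=> Soff.
have blk sel e' : filter S (block sel e') = [::].
  apply/eqP; rewrite -size_eq0 size_filter -leqn0 leqNgt -has_count.
  by apply/hasPn => a /mem_block; apply: contraTN => /Soff.
by elim: L e => [|y L IHL] e /=; rewrite ?filter_cat blk //= IHL.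
Qed.

(** Separators and other cycles are invisible to the letters of [c], which form one power of [c]
    across all segments; distinct letters of [c] therefore separate each other. *)
Lemma filter_build_cycle (S : pred 'I_m) L e c : c \in cs ->
  (forall x, x \in L -> ~~ on_cs x) -> (forall a, S a -> a \in c) ->
  exists n, filter S (build L e) = rounds (filter S c) n.
Proof.
move=> cin Loff Sc; elim: L Loff e => [|y L IHL] Loff e.
  by exists (e c 0).+1; rewrite /= (filter_block _ _ cin) // => a /Sc.
have [|n /= eqn] := IHL _ (fun c => if y \in attached c then fun i => e c i.+1 else e c).
  by move=> x xL; apply: Loff; rewrite inE xL orbT.
rewrite filter_cat (filter_block _ _ cin) => [|a /Sc //]; rewrite /= eqn.
have -> : S y = false.
  apply: contraNF (Loff y (mem_head _ _)) => /Sc; exact: on_csI.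
case: ifP => _; last by exists n.
by exists ((e c 0).+1 + n); rewrite -roundsD.
Qed.

Lemma spaced_rounds x y n c : uniq c -> x \in c -> y \in c -> x != y ->
  spaced x (pred1 y) false (rounds (filter (pred2 x y) c) n).
Proof.
move=> uc xc yc nxy.
have us : uniq (filter (pred2 x y) c) by rewrite filter_uniq.
have ms z : z \in filter (pred2 x y) c = (z \in [:: x; y]).
  by rewrite mem_filter !inE; case: eqP => [->|_]; case: eqP => [->|_].
have /perm_size : perm_eq (filter (pred2 x y) c) [:: x; y].
  by apply: uniq_perm; rewrite //= inE nxy.
move: (filter _ _) us ms => [|a [|b []]] //= us ms _.
have nyx : y != x by rewrite eq_sym.
have nab : a != b by move: us; rewrite inE => /andP[].
have := ms a; have := ms b; rewrite !inE !eqxx orbT /=.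
move=> /esym/orP[] /eqP eqb /esym/orP[] /eqP eqa; rewrite {}eqa {}eqb ?eqxx // in nab *.
  suff H b' : spaced x (pred1 y) b' (rounds [:: y; x] n) by [].
  elim: n b' => //= n IHn b'.
  by rewrite /= (negbTE nyx) !eqxx andbF /=.
by elim: n => //= n IHn; rewrite eqxx (negbTE nyx) eqxx.
Qed.

Lemma spaced_cat_any x (Y : pred 'I_m) u w b :
  x \notin u -> (forall b', spaced x Y b' w) -> spaced x Y b (u ++ w).
Proof.
elim: u b => //= a u IHu b; rewrite inE negb_or eq_sym => /andP[/negbTE -> nx] sp.
exact: IHu.
Qed.

Lemma spaced_cat_has x (Y : pred 'I_m) u w b :
  x \notin u -> has Y u -> spaced x Y false w -> spaced x Y b (u ++ w).
Proof.
elim: u b => //= a u IHu b; rewrite inE negb_or eq_sym => /andP[/negbTE -> nx].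
case Ya: (Y a) => /= hasu sp; last exact: IHu.
by rewrite andbF spaced_cat_notin.
Qed.

(** As [x] is attached to [c], the block directly before each [x] contains [y]. *)
Lemma spaced_build_attached c x y L e b : c \in cs -> y \in c -> adjacent arr x y ->
  ~~ on_cs x -> spaced x (pred1 y) b (build L e).
Proof.
move=> cin yc xy nx.
have nblk sel e' : x \notin block sel e' by apply: contra nx; apply: mem_block.
elim: L e b => [|z L IHL] e b /=; first exact: spaced_notin.
have [->|nzx] := eqVneq z x; last first.
  by apply: spaced_cat_any => // b'; rewrite /= (negbTE nzx).
apply: spaced_cat_has => //; last by rewrite /= eqxx.
apply/hasP; exists y; rewrite /= ?eqxx //; apply: (block_mem _ cin _ yc).
have /orP[xc|//] := adjacent_attached cin yc (etrans (adjacentC arr y x) xy).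
by case/negP: nx; apply: on_csI xc.
Qed.

Lemma spaced_build_off (r : rel 'I_m) x L e : (forall a, a \in L -> ~~ on_cs a) ->
  ~~ on_cs x -> spaced x (r x) false L -> spaced x (r x) false (build L e).
Proof.
move=> Loff nx sp; pose Y := [pred a | r x a && ~~ on_cs a].
pose S := [pred a | ~~ on_cs a].
have {}sp : spaced x Y false L.
  by apply: spaced_sub sp => // a /Loff na /= ->.
apply: (@spaced_sub _ x Y _ false) => // [a _ /andP[] //|].
rewrite -(@spaced_filter _ x Y S) //; last by move=> a /andP[].
by rewrite filter_build_off // spaced_filter // => a /andP[].
Qed.

Lemma reduced_build L e : (forall x, x \in L -> ~~ on_cs x) ->
  well_spaced_separators arr L -> well_spaced_separators (rev_rel arr) L ->
  reduced arr (build L e).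
Proof.
move=> Loff sp1 sp2; apply/reducedP => x; case: (boolP (on_cs x)) => [/hasP[c cin xc]|nx].
  have uc := cs_uniq enum_cs cin.
  have key (r : rel 'I_m) y : y \in c -> r x y -> x != y -> spaced x (r x) false (build L e).
    move=> yc xy nxy; apply: (@spaced_sub _ x (pred1 y) _ false) => // [a _ /eqP -> //|].
    rewrite -(@spaced_filter _ x (pred1 y) (pred2 x y)) /= ?eqxx //; last first.
      by move=> a ->; rewrite orbT.
    have [|n ->] := @filter_build_cycle (pred2 x y) L e c cin Loff.
      by move=> a /orP[] /eqP ->.
    exact: spaced_rounds.
  have neq y : adjacent arr x y -> x != y.
    by move=> xy; apply: contraTneq xy => <-; rewrite /adjacent arr_irr.
  have xn := cs_arr_next enum_cs cin xc; have px := cs_arr_prev enum_cs cin xc.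
  split.
    by apply: (key _ (next c x)); rewrite ?mem_next // neq // /adjacent xn.
  by apply: (key _ (prev c x)); rewrite ?mem_prev // neq // /adjacent px orbT.
have [xL|nxL] := boolP (x \in L); last first.
  have nxb : x \notin build L e by apply: contra nxL => /mem_build; rewrite (negbTE nx).
  by split; apply: spaced_notin.
have key (r : rel 'I_m) : (forall y, r x y -> adjacent arr x y) ->
    well_spaced_separators r L -> spaced x (r x) false (build L e).
  move=> radj /(_ x xL)[[c [y [cin yc xy]]]|sp]; last exact: spaced_build_off.
  apply: (@spaced_sub _ x (pred1 y) _ false) => // [a _ /eqP -> //|].
  exact: spaced_build_attached cin yc (radj y xy) nx.
by split; apply: key => // y; rewrite /adjacent /rev_rel => ->; rewrite ?orbT.
Qed.

Lemma rounds_cat_inj s n n' x u u' : x \notin s -> 0 < size s ->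
  rounds s n ++ x :: u = rounds s n' ++ x :: u' -> n = n'.
Proof.
move=> xs s0 /(congr1 (index x)).
have nr k : x \in rounds s k = false by apply: contraNF xs; apply: mem_rounds.
by rewrite !index_cat !nr /= eqxx !addn0 !size_rounds => /eqP; rewrite eqn_pmul2r // => /eqP.
Qed.

(** The exponent before the first separator [x] is read from the projection onto [x] and an adjacent
    vertex [z] of the cycle, as the number of [z] before the first [x]. Equal blocks are then
    cancelled; the final exponents are read from the number of occurrences. *)
Lemma build_inj L e e' : (forall x, x \in L -> ~~ on_cs x) ->
  same_projections arr (build L e) (build L e') ->
  forall c i, c \in cs -> i <= count [in attached c] L -> e c i = e' c i.
Proof.
elim: L e e' => [|x L IHL] e e' Loff prj c i cin lei.
  move: lei; rewrite leqn0 => /eqP ->.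
  have /and3P[] := cs_is_cycle enum_cs cin; case def_c: c => [|z c'] // _ uc _.
  have := prj z z; rewrite eqxx => /(_ isT).
  have Sc a : pred2 z z a -> on_cs a -> a \in c.
    by move=> /orP[] /eqP -> _; rewrite def_c mem_head.
  rewrite /= !(filter_block _ _ cin Sc) => /(congr1 size).
  rewrite !size_rounds => /eqP; rewrite eqn_pmul2r => [/eqP[]|]; first by rewrite def_c.
  by rewrite size_filter -has_count; apply/hasP; exists z; rewrite /= ?eqxx // def_c mem_head.
have nx := Loff x (mem_head _ _).
have head_eq d : d \in cs -> x \in attached d -> e d 0 = e' d 0.
  move=> din xd; have [z zd xz] := attachedP xd.
  have Sd a : pred2 x z a -> on_cs a -> a \in d.
    by case/orP=> /eqP ->; rewrite ?(negbTE nx).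
  have := prj x z; rewrite xz orbT => /(_ isT).
  rewrite /= !filter_cat !(filter_block _ _ din Sd) xd /= eqxx /=.
  move/rounds_cat_inj => H; apply: succn_inj; apply: H.
    by rewrite mem_filter; apply: contra nx => /andP[_]; apply: on_csI.
  by rewrite size_filter -has_count; apply/hasP; exists z; rewrite /= ?eqxx ?orbT.
have block_eq : block (fun c => x \in attached c) e = block (fun c => x \in attached c) e'.
  rewrite /block; congr flatten; apply/eq_in_map => d.
  by rewrite mem_filter => /andP[xd din]; rewrite head_eq.
pose sh (f : seq 'I_m -> nat -> nat) := fun c => if x \in attached c then fun i => f c i.+1 else f c.
have prj' : same_projections arr (build L (sh e)) (build L (sh e')).
  move=> a b ab; have := prj a b ab; rewrite /= -block_eq !filter_cat /= => /eqP.
  by rewrite eqseq_cat // eqxx /=; case: ifP => _ /eqP //; case.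
have Loff' y : y \in L -> ~~ on_cs y by move=> yL; apply: Loff; rewrite inE yL orbT.
have IH := IHL _ _ Loff' prj' c.
move: lei; rewrite /=; case: (boolP (x \in attached c)) => xc.
  case: i => [|i] lei; first exact: head_eq.
  by have := IH i cin lei; rewrite /sh xc.
by move=> lei; have := IH i cin lei; rewrite /sh (negbTE xc).
Qed.

Lemma size_build L e n : (forall c i, e c i < n) ->
  size (build L e) <= (size L).+1 * (size cs * (n * m)) + size L.
Proof.
have uc c : c \in cs -> size c <= m.
  by move/(cs_uniq enum_cs) => /card_uniqP <-; rewrite -[m in _ <= m]card_ord max_card.
have blk sel e' : (forall c i, e' c i < n) -> size (block sel e') <= size cs * (n * m).
  move=> lte; rewrite /block size_flatten /shape -map_comp.
  apply: (@leq_trans (sumn [seq n * m | c <- cs])); last first.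
    by elim: (cs) => //= a s IHs; rewrite mulSn leq_add2l.
  elim: (cs) uc => //= c s IHs ucs; have {}IHs := IHs (fun d ds => ucs d (mem_behead (s := c :: s) ds)).
  case: (sel c) => /=; last exact: leq_trans IHs (leq_addl _ _).
  by rewrite leq_add // size_rounds leq_mul // ucs ?mem_head.
elim: L e => [|x L IHL] e lte /=; first by rewrite mul1n addn0 blk.
rewrite size_cat /= mulSn -addnA leq_add ?blk // addnS ltnS; apply: IHL => c i.
by case: ifP.
Qed.

Lemma dim_VN_lower (K : fieldType) :
  exists2 k, 0 < k & forall n N, 0 < n -> n * k <= N ->
    n ^ (\sum_(c <- cs) nseg arr c) <= dim_VN K arr N.
Proof.
have [L [Loff Lcount sp1 sp2]] := exists_separators.
(* Chosen so that [n * k] dominates the bound of [size_build]. *)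
exists ((size L).+1 * (size cs * m) + (size L).+1); first by rewrite addnS.
move=> n N n0 leN.
(* Each [f] prescribes one exponent per segment; the default [0] is used only for pairs that index
   no segment. *)
pose e (f : {ffun seg_index arr cs -> 'I_n}) c i : nat :=
  if [pick p : seg_index arr cs | (nth [::] cs (tag p) == c) && (val (tagged p) == i)]
    is Some p then f p else 0.
have [_ _ uniq_cs _] := enum_cs.
have eE f (p : seg_index arr cs) : e f (nth [::] cs (tag p)) (tagged p) = f p.
  rewrite /e; case: pickP => [p' /andP[/eqP eqc /eqP eqi]|/(_ p)]; last by rewrite !eqxx.
  suff -> : p' = p by [].
  case: p' p eqc eqi => [j i] [j' i'] /= /eqP.
  rewrite nth_uniq // => /eqP /val_inj eqj; case: j' / eqj i' => i' eqi.
  by congr existT; apply: val_inj.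
have lte f c i : e f c i < n by rewrite /e; case: pickP.
rewrite -card_seg_index -[n in n ^ _]card_ord -card_ffun.
apply: (@dim_VN_ge _ _ _ _ (fun f => build L (e f))) => [f|f f' eqf].
  apply: leq_trans (size_build L (lte f)) _; apply: leq_trans leN.
  rewrite mulnDr leq_add //; first by rewrite [leqRHS]mulnCA [n * (size cs * _)]mulnCA.
  by apply: leq_trans (leqnSn _) _; apply: leq_pmull.
apply/ffunP => p; apply: val_inj; rewrite /= -!eE.
have cin : nth [::] cs (tag p) \in cs by apply: mem_nth.
have red g := reduced_build (e g) Loff sp1 sp2.
apply: (build_inj Loff (hk_eq_reduced simple (red f) (red f') eqf) cin).
by rewrite -ltnS Lcount.
Qed.

End LowerBound.

(** * The dimension formula *)

Lemma GKdim_HK_eq (K : fieldType) (R : realType) (m : nat) (arr : rel 'I_m)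
    (cs : seq (seq 'I_m)) :
  simple_oriented arr -> no_linked_cycles arr -> cycle_enumeration arr cs ->
  GKdim_HK K R arr = (((\sum_(c <- cs) nseg arr c)%N)%:R : R)%:E.
Proof.
move=> simple nolink enum_cs.
have [C upper] := dim_VN_upper simple nolink enum_cs K.
have [k k0 lower] := dim_VN_lower simple nolink enum_cs K.
exact: limn_esup_growth k0 upper lower.
Qed.

Theorem theorem3p6 (K : fieldType) (R : realType) (m : nat) (arr : rel 'I_m) :
  simple_oriented arr ->
  (forall cs : seq (seq 'I_m),
     cycle_enumeration arr cs -> (0 < size cs)%N -> no_linked_cycles arr ->
     (forall x : 'I_m, ~ on_cycle arr x ->
        ~ ((exists y, on_cycle arr y /\ connect arr x y) /\
           (exists z, on_cycle arr z /\ connect arr z x))) /\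
     GKdim_HK K R arr =
       (((\sum_(c <- cs) (\sum_(x in attached arr c) k_x arr c x + 1))%N)%:R : R)%:E)
  /\
  ((forall c : seq 'I_m, ~~ is_cycle arr c) -> GKdim_HK K R arr = (0%R : R)%:E).
Proof.
move=> simple; split=> [cs enum_cs _ nolink|acyclic].
  split; last exact: GKdim_HK_eq simple nolink enum_cs.
  by move=> x; apply: on_cycle_exclusive.
(* Without cycles, the empty list enumerates them and the sum is empty. *)
have -> : (0 : R)%R = ((\sum_(c <- [::]) nseg arr c)%N)%:R%R by rewrite big_nil.
apply: GKdim_HK_eq => //.
  by move=> c c' x y cyc; move: (acyclic c); rewrite cyc.
by split=> // c cyc; move: (acyclic c); rewrite cyc.
Qed.
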